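(* Let $\mathcal L$ be the even liaison class of a tetrahedral curve that is not arithmetically Cohen–Macaulay. Then $\mathcal L$ contains only finitely many tetrahedral curves whose ideals have a linear resolution.
   Context: Let $k$ be a field, $R=k[a,b,c,d]$. For nonnegative integers $a_1,\dots,a_6$, the tetrahedral curve $(a_1,\dots,a_6)$ is the curve in $\mathbb P^3$ with ideal $(a,b)^{a_1}\cap(a,c)^{a_2}\cap(a,d)^{a_3}\cap(b,c)^{a_4}\cap(b,d)^{a_5}\cap(c,d)^{a_6}$. The even liaison class of a curve is its equivalence class under linkage in an even number of steps by complete intersections. An ideal has a linear resolution if it is generated in one degree $d$ and the $i$-th module of its minimal free resolution is generated in degree $d+i$. *)

(* Defs.v *)
From HB Require Import structures.
From mathcomp Require Import all_boot all_order all_algebra.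
From mathcomp Require Import mpoly.
Set Implicit Arguments. Unset Strict Implicit. Unset Printing Implicit Defensive.
Import GRing.Theory.
Local Open Scope ring_scope.

Notation Rpoly k := {mpoly k[4]}.

Definition ideal (k : fieldType) := Rpoly k -> Prop.

Definition ideal_eq (k : fieldType) (I J : ideal k) : Prop := forall f, I f <-> J f.

Definition ideal_span (k : fieldType) (S : Rpoly k -> Prop) : ideal k :=
  fun f => exists (n : nat) (r s : 'I_n -> Rpoly k),
    (forall i, S (s i)) /\ f = \sum_(i < n) r i * s i.

Definition ideal_pow (k : fieldType) (I : ideal k) (m : nat) : ideal k :=
  ideal_span (fun f => exists s : 'I_m -> Rpoly k,
                 (forall i, I (s i)) /\ f = \prod_(i < m) s i).

Definition ideal_cap (k : fieldType) (I J : ideal k) : ideal k := fun f => I f /\ J f.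

Definition ideal_add (k : fieldType) (I J : ideal k) : ideal k :=
  fun f => exists x y, I x /\ J y /\ f = x + y.

Definition ideal_colon (k : fieldType) (I J : ideal k) : ideal k :=
  fun f => forall g, J g -> I (f * g).

Definition var_ideal2 (k : fieldType) (i j : 'I_4) : ideal k :=
  ideal_span (fun f => f = 'X_i \/ f = 'X_j).

Definition irrelevant (k : fieldType) : ideal k :=
  ideal_span (fun f => exists i : 'I_4, f = 'X_i).

Definition principal (k : fieldType) (f : Rpoly k) : ideal k :=
  ideal_span (fun g => g = f).

(** Homogeneous polynomial of degree d (0 is homogeneous of every degree). *)
Definition homogeneous (k : fieldType) (d : nat) (p : Rpoly k) : bool :=
  all (fun m => mdeg m == d) (msupp p).

Definition tetrahedral (k : fieldType) (t : 6.-tuple nat) : ideal k :=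
  ideal_cap (ideal_pow (@var_ideal2 k 0 1) (tnth t 0))
 (ideal_cap (ideal_pow (@var_ideal2 k 0 2) (tnth t 1))
 (ideal_cap (ideal_pow (@var_ideal2 k 0 3) (tnth t 2))
 (ideal_cap (ideal_pow (@var_ideal2 k 1 2) (tnth t 3))
 (ideal_cap (ideal_pow (@var_ideal2 k 1 3) (tnth t 4))
            (ideal_pow (@var_ideal2 k 2 3) (tnth t 5)))))).

Definition nzd_mod (k : fieldType) (I : ideal k) (f : Rpoly k) : Prop :=
  forall h, I (h * f) -> I h.

(** Arithmetically Cohen–Macaulay: R/I is Cohen–Macaulay.  For a curve
    (dim R/I = 2) this means depth_m(R/I) >= 2, i.e. there is an
    R/I-regular sequence of length 2 in the irrelevant ideal m.
    The empty curve (I = R) is ACM by convention. *)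
Definition ACM (k : fieldType) (I : ideal k) : Prop :=
  (forall f, I f) \/
  exists f g, @irrelevant k f /\ @irrelevant k g /\
    nzd_mod I f /\ nzd_mod (ideal_add I (principal f)) g.

Definition CI_ideal (k : fieldType) (X : ideal k) : Prop :=
  exists (F G : Rpoly k) (dF dG : nat),
    (0 < dF)%N /\ (0 < dG)%N /\ homogeneous dF F /\ homogeneous dG G /\
    F != 0 /\ nzd_mod (principal F) G /\
    ideal_eq X (ideal_span (fun h => h = F \/ h = G)).

Definition directly_linked (k : fieldType) (I J : ideal k) : Prop :=
  exists X : ideal k, CI_ideal X /\
    (forall f, X f -> I f /\ J f) /\
    ideal_eq (ideal_colon X I) J /\ ideal_eq (ideal_colon X J) I.

Definition evenly_linked (k : fieldType) (I J : ideal k) : Prop :=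
  exists (m : nat) (s : nat -> ideal k),
    ideal_eq (s 0%N) I /\ ideal_eq (s (2 * m)%N) J /\
    forall i, (i < 2 * m)%N -> directly_linked (s i) (s i.+1).

(** I has a linear resolution: I is generated in one degree d and has a
    (necessarily minimal, since all differentials have linear entries)
    finite graded free resolution
      0 -> ... -> F_1 -> F_0 -> I -> 0,  F_i = R(-d-i)^(n i),
    with F_{i+1} -> F_i given by v |-> v *m M i (row vectors). *)
Definition linear_resolution (k : fieldType) (I : ideal k) : Prop :=
  exists (d : nat) (n : nat -> nat) (g : 'cV[Rpoly k]_(n 0%N))
         (M : forall i : nat, 'M[Rpoly k]_(n i.+1, n i)),
    (forall j, homogeneous d (g j 0)) /\
    ideal_eq I (ideal_span (fun f => exists j, f = g j 0)) /\
    (forall i j l, homogeneous 1 (M i j l)) /\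
    M 0%N *m g = 0 /\
    (forall i, M i.+1 *m M i = 0) /\
    (forall v : 'rV[Rpoly k]_(n 0%N), v *m g = 0 ->
        exists w : 'rV[Rpoly k]_(n 1%N), v = w *m M 0%N) /\
    (forall i (v : 'rV[Rpoly k]_(n i.+1)), v *m M i = 0 ->
        exists w : 'rV[Rpoly k]_(n i.+2), v = w *m M i.+1) /\
    (exists p, forall i, (p <= i)%N -> n i = 0%N).

(* Main.v *)
Require Import Defs.
From mathcomp Require Import all_boot all_order all_algebra.
From mathcomp Require Import mpoly ring zify.
Set Implicit Arguments. Unset Strict Implicit. Unset Printing Implicit Defensive.
Import GRing.Theory.
Local Open Scope ring_scope.

(** Let M(I) be the deficiency module of R/I: sections of the structure sheaf
    over the punctured spectrum, as Cech families (u_i / x_i^n), modulo R.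

    If J is linked to I by (f,g) and to I' by (f',g'), then dim M(I) = dim M(I').
    For complete intersections sharing a generator, (f,g1) and (f,g2), a section
    u of R/((f,g2):J) has g1 u_i = q x_i^n + g2 u'_i mod f for some q, because g1
    lies in J and R/(f,g2) has depth at least 2 (Koszul cohomology); u |-> u' is
    the required isomorphism modulo R.  In general one passes to R[t] and goes
    (f,g) = (f,g+tf) -> (f',g+tf) -> (f',g'), then sets t = 0.

    For a tetrahedral curve with weights w_ij, M has a basis indexed by the
    exponents m for which m_i + m_j < w_ij holds on exactly two opposite edges
    ij, hl.  If M = 0 the curve is ACM, with regular sequence e1, e2.
    If the ideal is generated in degree d and such an m exists, raising m_i and
    m_h gives a monomial of degree w_ij + w_hl in the ideal, so
    d <= w_ij + w_hl; monomials in three variables give sum_j w_vj <= d for each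
    vertex v.  These inequalities produce at least max(w_ij, w_hl) - 2 basis
    elements of M, so d and all weights are bounded by dim M.  Of the linear
    resolution, only generation in a single degree matters. *)

(** * Koszul cohomology modulo an ideal *)

Section Koszul.
Variables (A : comNzRingType) (y : 'I_4 -> A).

Definition is_ideal (Q : A -> Prop) :=
  [/\ Q 0, forall a b, Q a -> Q b -> Q (a + b) & forall a b, Q b -> Q (a * b)].

Definition adjoin (Q : A -> Prop) (g f : A) := exists a, Q (f - a * g).

Definition nzd (Q : A -> Prop) (g : A) := forall a, Q (a * g) -> Q a.

Lemma is_idealN Q a : is_ideal Q -> Q a -> Q (- a).
Proof. by case=> _ _ H /(H (-1)); rewrite mulN1r. Qed.

Lemma is_idealB Q a b : is_ideal Q -> Q a -> Q b -> Q (a - b).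
Proof. by move=> HQ Qa /(is_idealN HQ); case: HQ => _ H _; apply: H. Qed.

Lemma is_ideal_adjoin Q g : is_ideal Q -> is_ideal (adjoin Q g).
Proof.
case=> Q0 QD QM; split.
- by exists 0; rewrite mul0r subr0.
- move=> a b [a' Qa] [b' Qb]; exists (a' + b').
  have -> : a + b - (a' + b') * g = (a - a' * g) + (b - b' * g) by ring.
  exact: QD.
- move=> a b [b' Qb]; exists (a * b').
  have -> : a * b - a * b' * g = a * (b - b' * g) by ring.
  exact: QM.
Qed.

(** [koszul0] to [koszul3] express the vanishing of Koszul cohomology of [y] on A/Q in degrees 0 to
    3. Cochains are functions on all index tuples instead of alternating ones, so no ordering of the
    indices is needed. *)
Definition koszul0 (Q : A -> Prop) := forall a, (forall i, Q (a * y i)) -> Q a.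

Definition koszul1 (Q : A -> Prop) := forall u : 'I_4 -> A,
  (forall i j, Q (u i * y j - u j * y i)) ->
  exists v, forall i, Q (u i - v * y i).

Definition koszul2 (Q : A -> Prop) := forall u : 'I_4 -> 'I_4 -> A,
  (forall i j k, Q (u j k * y i - u i k * y j + u i j * y k)) ->
  exists v : 'I_4 -> A, forall i j, Q (u i j - (v i * y j - v j * y i)).

Definition koszul3 (Q : A -> Prop) := forall u : 'I_4 -> 'I_4 -> 'I_4 -> A,
  (forall i j k l,
     Q (u j k l * y i - u i k l * y j + u i j l * y k - u i j k * y l)) ->
  exists v : 'I_4 -> 'I_4 -> A, forall i j k,
    Q (u i j k - (v j k * y i - v i k * y j + v i j * y k)).

Section OneIdeal.
Variable Q : A -> Prop.
Hypothesis idQ : is_ideal Q.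

Let QD a b : Q a -> Q b -> Q (a + b). Proof. by case: idQ => _ H _; apply: H. Qed.
Let QB a b : Q a -> Q b -> Q (a - b). Proof. exact: is_idealB. Qed.
Let QM a b : Q b -> Q (a * b). Proof. by case: idQ => _ _; apply. Qed.

Lemma koszul0_nzd e : nzd Q (y e) -> koszul0 Q.
Proof. by move=> nz a /(_ e) /nz. Qed.

(** By the cocycle identity, the slice of a cocycle at [e] is a cocycle modulo [y e], hence a
    coboundary there. The leftover multipliers of [y e] form, up to sign, a primitive of the whole
    cocycle once [y e] is cancelled. The same argument serves in degrees 2 and 3. *)
Lemma koszul1_adjoin e : nzd Q (y e) -> koszul0 (adjoin Q (y e)) -> koszul1 Q.
Proof.
move=> nz K u cu; have [|v Qv] := K (u e).
  move=> i; exists (u i); exact: cu.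
exists v => i; apply: nz.
have -> : (u i - v * y i) * y e = (u i * y e - u e * y i) + y i * (u e - v * y e) by ring.
by apply: QD; [apply: cu | apply: QM].
Qed.

Lemma koszul2_adjoin e : nzd Q (y e) -> koszul1 (adjoin Q (y e)) -> koszul2 Q.
Proof.
move=> nz K u cu; have [|v Qv] := K (u e).
  move=> i j; exists (- u i j).
  have -> : u e i * y j - u e j * y i - - u i j * y e
     = u i j * y e - u e j * y i + u e i * y j by ring.
  exact: cu.
have [t Ht] := fin_all_exists Qv.
exists (fun i => - t i) => i j; apply: nz.
have -> : (u i j - (- t i * y j - - t j * y i)) * y e =
   (u i j * y e - u e j * y i + u e i * y j)
   + (y i * (u e j - v * y j - t j * y e) - y j * (u e i - v * y i - t i * y e)) by ring.
by apply: QD; [apply: cu | apply: QB; apply: QM].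
Qed.

Lemma koszul3_adjoin e : nzd Q (y e) -> koszul2 (adjoin Q (y e)) -> koszul3 Q.
Proof.
move=> nz K u cu; have [|v Qv] := K (u e).
  move=> i j k; exists (u i j k).
  have -> : u e j k * y i - u e i k * y j + u e i j * y k - u i j k * y e
     = 0 - (u i j k * y e - u e j k * y i + u e i k * y j - u e i j * y k) by ring.
  by apply: QB; [case: idQ | apply: cu].
have [t Ht] := fin_all_exists (fun i => fin_all_exists (Qv i)).
exists t => i j k; apply: nz.
have -> : (u i j k - (t j k * y i - t i k * y j + t i j * y k)) * y e =
   (u i j k * y e - u e j k * y i + u e i k * y j - u e i j * y k)
   + (y i * (u e j k - (v j * y k - v k * y j) - t j k * y e)
      - y j * (u e i k - (v i * y k - v k * y i) - t i k * y e)
      + y k * (u e i j - (v i * y j - v j * y i) - t i j * y e)) by ring.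
by apply: QD; [apply: cu | apply: QD; [apply: QB|]; apply: QM].
Qed.

Variable g : A.
Hypothesis nzg : nzd Q g.

(** From 0 -> A/Q -> A/Q -> A/(Q,g) -> 0, degree i of the quotient lies between degrees i and i+1 of
    A/Q. The family [b], a coboundary divided by [g], is the image under the connecting map. Degrees
    1 and 2 follow the same way. *)
Lemma koszul0_quot : koszul0 Q -> koszul1 Q -> koszul0 (adjoin Q g).
Proof.
move=> K0 K1 a /fin_all_exists [b Qb]; have [|v Qv] := K1 b.
  move=> i j; apply: nzg.
  have -> : (b i * y j - b j * y i) * g =
     y i * (a * y j - b j * g) - y j * (a * y i - b i * g) by ring.
  by apply: QB; apply: QM.
exists v; apply: K0 => i.
have -> : (a - v * g) * y i = (a * y i - b i * g) + g * (b i - v * y i) by ring.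
by apply: QD => //; apply: QM.
Qed.

Lemma koszul1_quot : koszul1 Q -> koszul2 Q -> koszul1 (adjoin Q g).
Proof.
move=> K1 K2 u cu.
have [b Qb] := fin_all_exists (fun i => fin_all_exists (cu i)).
have [|v Qv] := K2 b.
  move=> i j k; apply: nzg.
  have -> : (b j k * y i - b i k * y j + b i j * y k) * g =
     y j * (u i * y k - u k * y i - b i k * g)
     - y i * (u j * y k - u k * y j - b j k * g)
     - y k * (u i * y j - u j * y i - b i j * g) by ring.
  by apply: QB; [apply: QB|]; apply: QM.
have [|w Qw] := K1 (fun i => u i - v i * g).
  move=> i j.
  have -> : (u i - v i * g) * y j - (u j - v j * g) * y i =
     (u i * y j - u j * y i - b i j * g) + g * (b i j - (v i * y j - v j * y i)) by ring.
  by apply: QD => //; apply: QM.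
by exists w => i; exists (v i); rewrite addrAC.
Qed.

Lemma koszul2_quot : koszul2 Q -> koszul3 Q -> koszul2 (adjoin Q g).
Proof.
move=> K2 K3 u cu.
have [b Qb] := fin_all_exists (fun i => fin_all_exists (fun j => fin_all_exists (cu i j))).
have [|v Qv] := K3 b.
  move=> i j k l; apply: nzg.
  have -> : (b j k l * y i - b i k l * y j + b i j l * y k - b i j k * y l) * g =
     y j * (u k l * y i - u i l * y k + u i k * y l - b i k l * g)
     - y i * (u k l * y j - u j l * y k + u j k * y l - b j k l * g)
     - y k * (u j l * y i - u i l * y j + u i j * y l - b i j l * g)
     + y l * (u j k * y i - u i k * y j + u i j * y k - b i j k * g) by ring.
  by apply: QD; [apply: QB; [apply: QB|]|]; apply: QM.
have [|w Qw] := K2 (fun i j => u i j - v i j * g).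
  move=> i j k.
  have -> : (u j k - v j k * g) * y i - (u i k - v i k * g) * y j
       + (u i j - v i j * g) * y k =
     (u j k * y i - u i k * y j + u i j * y k - b i j k * g)
     + g * (b i j k - (v j k * y i - v i k * y j + v i j * y k)) by ring.
  by apply: QD => //; apply: QM.
by exists w => i j; exists (v i j); rewrite addrAC.
Qed.

End OneIdeal.

End Koszul.

(** * Sections over the punctured spectrum *)

Section Sections.
Variables (A : comNzRingType) (x : 'I_4 -> A).

Definition colon (X J : A -> Prop) (f : A) := forall g, J g -> X (f * g).

Lemma is_ideal_colon X J : is_ideal X -> is_ideal (colon X J).
Proof.
case=> X0 XD XM; split=> [g _|a b Xa Xb g Jg|a b Xb g Jg].
- by rewrite mul0r.
- by rewrite mulrDl; apply: XD; [apply: Xa | apply: Xb].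
- by rewrite -mulrA; apply/XM/Xb.
Qed.

Lemma is_ideal_sum Q (T : finType) (f : T -> A) :
  is_ideal Q -> (forall p, Q (f p)) -> Q (\sum_p f p).
Proof. by case=> Q0 QD _ Qf; elim/big_ind: _ => // *; apply: QD. Qed.

(* A family [u] with [section I n u] is the section [u i / x i ^+ n] of the
   sheaf of [A / I] over the union of the open sets [x i != 0]. *)
Definition section (I : A -> Prop) n (u : 'I_4 -> A) :=
  forall i j, I (u i * x j ^+ n - u j * x i ^+ n).

(* The sections modulo [A] (for a curve, the deficiency module) are spanned over
   the scalars [K] by a family indexed by [T]. *)
Definition spanned (K I : A -> Prop) (T : finType) :=
  exists n0 (s : T -> 'I_4 -> A), (forall p, section I n0 (s p)) /\
  forall n u, section I n u -> exists (c : T -> A) r m, (forall p, K (c p)) /\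
    forall i, I ((u i * x i ^+ n0 - \sum_p c p * s p i * x i ^+ n
                  - r * x i ^+ (n + n0)) * x i ^+ m).

Section Swap.
Variables (Q J : A -> Prop).
Hypothesis idQ : is_ideal Q.

Let QD a b : Q a -> Q b -> Q (a + b). Proof. by case: idQ => _ H _; apply: H. Qed.
Let QB a b : Q a -> Q b -> Q (a - b). Proof. exact: is_idealB. Qed.
Let QM a b : Q b -> Q (a * b). Proof. by case: idQ => _ _; apply. Qed.

(** [Q] stands for the ideal of the shared generator; [q] comes from Koszul vanishing in degree 1.
    That [u'] is a section is seen after multiplying by [g2]: the [q] terms cancel between the two
    charts, and then [g2] is removed. *)
Lemma section_transfer g1 g2 n u :
  J g1 -> nzd Q g2 -> koszul1 (fun i => x i ^+ n) (adjoin Q g2) ->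
  section (colon (adjoin Q g2) J) n u ->
  exists u' q, section (colon (adjoin Q g1) J) n u' /\
    forall i, Q (u i * g1 - q * x i ^+ n - u' i * g2).
Proof.
move=> J1 nz2 K1 su.
have [|q Hq] := K1 (fun i => u i * g1).
  move=> i j; have := su i j _ J1; congr adjoin; ring.
have [u' Hu'] := fin_all_exists Hq.
exists u', q; split=> // i j g Jg.
have [b Hb] := su i j _ Jg; exists b; apply: nz2.
have -> : ((u' i * x j ^+ n - u' j * x i ^+ n) * g - b * g1) * g2 =
  (g * x i ^+ n) * (u j * g1 - q * x j ^+ n - u' j * g2)
  - (g * x j ^+ n) * (u i * g1 - q * x i ^+ n - u' i * g2)
  + g1 * ((u i * x j ^+ n - u j * x i ^+ n) * g - b * g2) by ring.
by apply: QD; [apply: QB|]; apply: QM.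
Qed.

(** Injectivity of the transfer modulo global elements: if [u'] comes from [r], testing against [g2]
    in [J] puts [q + r * g2] into the ideal of [Q] and [g1], and its cofactor [r'] is the global
    element for [u]. *)
Lemma section_transfer_trivial g1 g2 n m q r u u' :
  J g2 -> nzd Q g1 -> koszul0 (fun i => x i ^+ (n + m)) (adjoin Q g1) ->
  (forall i, Q (u i * g1 - q * x i ^+ n - u' i * g2)) ->
  (forall i, colon (adjoin Q g1) J ((u' i - r * x i ^+ n) * x i ^+ m)) ->
  exists r', forall i, colon (adjoin Q g2) J ((u i - r' * x i ^+ n) * x i ^+ m).
Proof.
move=> J2 nz1 K0 Hu Hr.
have [r' Hr'] : adjoin Q g1 (q + r * g2).
  apply: K0 => i; have [b Hb] := Hr i _ J2; exists (x i ^+ m * u i - b).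
  have -> : (q + r * g2) * x i ^+ (n + m) - (x i ^+ m * u i - b) * g1 =
    0 - x i ^+ m * (u i * g1 - q * x i ^+ n - u' i * g2)
    - ((u' i - r * x i ^+ n) * x i ^+ m * g2 - b * g1) by rewrite exprD; ring.
  by apply: QB => //; apply: QB; [case: idQ | apply: QM].
exists r' => i g Jg; have [b Hb] := Hr i _ Jg; exists b; apply: nz1.
have -> : ((u i - r' * x i ^+ n) * x i ^+ m * g - b * g2) * g1 =
  (x i ^+ m * g) * (u i * g1 - q * x i ^+ n - u' i * g2)
  + (x i ^+ m * g * x i ^+ n) * (q + r * g2 - r' * g1)
  + g2 * ((u' i - r * x i ^+ n) * x i ^+ m * g - b * g1) by ring.
by apply: QD; [apply: QD|]; apply: QM.
Qed.

Lemma spanned_swap K T g1 g2 :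
  J g1 -> J g2 -> nzd Q g1 -> nzd Q g2 ->
  (forall n, koszul0 (fun i => x i ^+ n) (adjoin Q g1)) ->
  (forall n, koszul1 (fun i => x i ^+ n) (adjoin Q g1)) ->
  (forall n, koszul1 (fun i => x i ^+ n) (adjoin Q g2)) ->
  spanned K (colon (adjoin Q g1) J) T -> spanned K (colon (adjoin Q g2) J) T.
Proof.
move=> J1 J2 nz1 nz2 K0 K1 K2 [n0 [s [ss Hs]]].
have [s' Hs'] := fin_all_exists (fun p => section_transfer J2 nz1 (K1 n0) (ss p)).
have [qs Hqs] := fin_all_exists Hs'.
exists n0, s'; split=> [p|n u su]; first by case: (Hqs p).
have [u' [q [su' Hu']]] := section_transfer J1 nz2 (K2 n) su.
have [c [r [m [Kc Hc]]]] := Hs _ _ su'.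
pose D (u : 'I_4 -> A) (s : T -> 'I_4 -> A) i :=
  u i * x i ^+ n0 - \sum_p c p * s p i * x i ^+ n.
(* The relations linking [u] to [u'] and [s p] to [s' p] combine linearly, so the defect of [u]
   against the [s' p] is linked to that of [u'] against the [s p], already known to be global. *)
have rel i : Q (D u s' i * g1 - (q + \sum_p c p * qs p) * x i ^+ (n + n0) - D u' s i * g2).
  have -> : D u s' i * g1 - (q + \sum_p c p * qs p) * x i ^+ (n + n0) - D u' s i * g2 =
    x i ^+ n0 * (u i * g1 - q * x i ^+ n - u' i * g2)
    + \sum_p (c p * x i ^+ n) * (s p i * g2 - qs p * x i ^+ n0 - s' p i * g1).
    have -> : \sum_p (c p * x i ^+ n) * (s p i * g2 - qs p * x i ^+ n0 - s' p i * g1) =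
       (\sum_p c p * s p i * x i ^+ n) * g2 - (\sum_p c p * qs p) * x i ^+ (n + n0)
       - (\sum_p c p * s' p i * x i ^+ n) * g1.
      rewrite !mulr_suml -!sumrB; apply: eq_bigr => p _; rewrite exprD; ring.
    by rewrite /D exprD; ring.
  apply: QD; first exact: QM.
  by apply: is_ideal_sum => // p; apply: QM; case: (Hqs p).
have [r' Hr'] := section_transfer_trivial J2 nz1 (K0 _) rel Hc.
by exists c, r', m.
Qed.

End Swap.
End Sections.

(** * Invariance under double links *)

Section Multiples.
Variable A : idomainType.

Definition zeroI (a : A) := a = 0.
Definition multiples (g : A) := adjoin zeroI g.

Lemma is_ideal_zeroI : is_ideal zeroI.
Proof.
by split=> // [a b -> ->|a b ->]; rewrite /zeroI ?addr0 ?mulr0.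
Qed.

Lemma multiplesP g f : multiples g f <-> exists a, f = a * g.
Proof.
split=> -[a Ha]; exists a; last by rewrite Ha /zeroI subrr.
by apply/eqP; rewrite -subr_eq0; apply/eqP.
Qed.

Lemma is_ideal_multiples g : is_ideal (multiples g).
Proof. exact/is_ideal_adjoin/is_ideal_zeroI. Qed.

Lemma nzd_zeroI g : g != 0 -> nzd zeroI g.
Proof. by move=> g0 a /eqP; rewrite mulf_eq0 (negPf g0) orbF => /eqP. Qed.

Lemma nzd_multiplesC f g : f != 0 -> nzd (multiples f) g -> nzd (multiples g) f.
Proof.
move=> f0 nz a /multiplesP [b Hb]; apply/multiplesP.
have /nz/multiplesP [c Hc] : multiples f (b * g) by apply/multiplesP; exists a.
exists c; apply: (mulIf f0); rewrite Hb Hc; ring.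
Qed.

Lemma pairC f g h : adjoin (multiples f) g h -> adjoin (multiples g) f h.
Proof. by move=> [a [b H]]; exists b, a; rewrite addrAC. Qed.

Lemma nzd_ext (Q Q' : A -> Prop) g : (forall f, Q f <-> Q' f) -> nzd Q g -> nzd Q' g.
Proof. by move=> QQ' nz a /QQ' /nz /QQ'. Qed.

Lemma adjoin_ext (Q Q' : A -> Prop) g :
  (forall f, Q f <-> Q' f) -> forall f, adjoin Q g f <-> adjoin Q' g f.
Proof. by move=> QQ' f; split=> -[a Ha]; exists a; apply/QQ'. Qed.

Lemma colon_ext (X X' J J' : A -> Prop) : (forall f, X f <-> X' f) ->
  (forall f, J f <-> J' f) -> forall f, colon X J f <-> colon X' J' f.
Proof. by move=> XX' JJ' f; split=> H g Jg; apply/XX'/H/JJ'. Qed.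

Lemma spanned_ext x (K I I' : A -> Prop) T :
  (forall f, I f <-> I' f) -> spanned x K I T -> spanned x K I' T.
Proof.
move=> II' [n0 [s [ss Hs]]]; exists n0, s; split=> [p i j|n u su]; first exact/II'/ss.
have [|c [r [m [Kc Hc]]]] := Hs n u; first by move=> i j; apply/II'/su.
by exists c, r, m; split=> // i; apply/II'/Hc.
Qed.

Definition regular_seq (y : 'I_4 -> A) :=
  [/\ y 0 != 0, nzd (multiples (y 0)) (y 1), nzd (adjoin (multiples (y 0)) (y 1)) (y 2%:R)
    & nzd (adjoin (adjoin (multiples (y 0)) (y 1)) (y 2%:R)) (y 3%:R)].

(** A regular sequence of length 4 kills degrees 0 to 3 over [A]; each of the two quotients costs
    one degree, which leaves degrees 0 and 1. *)
Lemma koszul_regular_quot (y : 'I_4 -> A) f g : regular_seq y ->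
  f != 0 -> nzd (multiples f) g ->
  koszul0 y (adjoin (multiples f) g) /\ koszul1 y (adjoin (multiples f) g).
Proof.
case=> y0 y1 y2 y3 f0 fg.
have id0 := is_ideal_zeroI; have id1 := is_ideal_multiples (y 0).
have id2 := is_ideal_adjoin (y 1) id1; have idf := is_ideal_multiples f.
have z0 := nzd_zeroI y0; have zf := nzd_zeroI f0.
have K0 : koszul0 y zeroI := koszul0_nzd z0.
have K1 : koszul1 y zeroI := koszul1_adjoin id0 z0 (koszul0_nzd y1).
have K2 : koszul2 y zeroI :=
  koszul2_adjoin id0 z0 (koszul1_adjoin id1 y1 (koszul0_nzd y2)).
have K3 : koszul3 y zeroI := koszul3_adjoin id0 z0
  (koszul2_adjoin id1 y1 (koszul1_adjoin id2 y2 (koszul0_nzd y3))).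
have L0 := koszul0_quot id0 zf K0 K1.
have L1 := koszul1_quot id0 zf K1 K2.
have L2 := koszul2_quot id0 zf K2 K3.
by split; [apply: koszul0_quot | apply: koszul1_quot].
Qed.

(** Comparing a f = b e with a g = c e gives b g = c f, so b = d f and a = d e. *)
Lemma nzd_multiples_joint e f g a :
  e != 0 -> f != 0 -> nzd (multiples f) g ->
  multiples e (a * f) -> multiples e (a * g) -> multiples e a.
Proof.
move=> e0 f0 nz /multiplesP [b Hb] /multiplesP [c Hc]; apply/multiplesP.
have /nz/multiplesP [d Hd] : multiples f (b * g).
  apply/multiplesP; exists c; apply: (mulIf e0).
  have -> : b * g * e = b * e * g by ring.
  have -> : c * f * e = c * e * f by ring.
  by rewrite -Hb -Hc; ring.
by exists d; apply: (mulIf f0); rewrite Hb Hd; ring.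
Qed.

Lemma nzd_multiples_jointX e f g i j a :
  e != 0 -> f != 0 -> nzd (multiples f) g ->
  multiples e (a * f ^+ i) -> multiples e (a * g ^+ j) -> multiples e a.
Proof.
move=> e0 f0 nz; have [_ _ QM] := is_ideal_multiples e.
elim: i a j => [|i IHi] a j; first by rewrite expr0 mulr1.
elim: j a => [|j IHj] a Hf Hg; first by move: Hg; rewrite expr0 mulr1.
apply: (nzd_multiples_joint e0 f0 nz).
  apply: (IHi _ j.+1); first by rewrite -mulrA -exprS.
  by rewrite mulrAC mulrC; apply: QM.
apply: IHj; first by rewrite mulrAC mulrC; apply: QM.
by rewrite -mulrA -exprS.
Qed.

End Multiples.

(** * Passage to the polynomial ring in one variable *)

Section PolyLift.
Variable R : idomainType.
Implicit Types (Q I J K : R -> Prop) (f : {poly R}).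

(** The extension of an ideal [Q] to the polynomial ring, in a form where membership is tested
    coefficientwise. *)
Definition coefI Q f := forall n, Q f`_n.

Lemma coefI_choice (P : R -> R -> Prop) f : P 0 0 ->
  (forall n, exists a, P f`_n a) -> exists h : {poly R}, forall n, P f`_n h`_n.
Proof.
move=> P0 H; have [h Hh] := fin_all_exists (fun l : 'I_(size f).+1 => H l).
exists (\poly_(l < size f) h (inord l)) => n; rewrite coef_poly.
case: ltnP => [n_lt|n_ge]; last by rewrite nth_default.
by have := Hh (inord n); rewrite inordK // ltnW.
Qed.

Lemma coefI_zeroI f : coefI (@zeroI R) f <-> zeroI f.
Proof.
split=> [H|-> n]; last by rewrite coef0.
by apply/polyP => n; rewrite coef0; apply: H.
Qed.

Lemma coefI_adjoin Q g f : Q 0 -> coefI (adjoin Q g) f <-> adjoin (coefI Q) g%:P f.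
Proof.
move=> Q0; split=> [H|[h Hh] n]; last by exists h`_n; have := Hh n; rewrite coefB coefMC.
have [|h Hh] := @coefI_choice (fun b a => Q (b - a * g)) f _ H; first by rewrite mul0r subr0.
by exists h => n; rewrite coefB coefMC.
Qed.

Lemma coefI_multiples g f : coefI (multiples g) f <-> multiples g%:P f.
Proof.
apply: (iff_trans (coefI_adjoin _ _ _)) => //.
exact: (adjoin_ext _ coefI_zeroI).
Qed.

Lemma coefI_pair g h f :
  coefI (adjoin (multiples g) h) f <-> adjoin (multiples g%:P) h%:P f.
Proof.
apply: (iff_trans (coefI_adjoin _ _ _)); first by case: (is_ideal_multiples g).
exact: (adjoin_ext _ (coefI_multiples g)).
Qed.

Lemma coefI_colon (X J : R -> Prop) f : is_ideal X -> J 0 ->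
  coefI (colon X J) f <-> colon (coefI X) (coefI J) f.
Proof.
move=> idX J0; split=> [H g Jg n|H n g Jg].
  by rewrite coefM; apply: is_ideal_sum => // i; apply/H/Jg.
have := H g%:P _ n; rewrite coefMC; apply => -[|l]; rewrite coefC //=.
Qed.

Lemma is_ideal_coefI Q : is_ideal Q -> is_ideal (coefI Q).
Proof.
move=> idQ; have [Q0 QD QM] := idQ; split=> [n|a b Qa Qb n|a b Qb n].
- by rewrite coef0.
- by rewrite coefD; apply: QD.
- by rewrite coefM; apply: is_ideal_sum => // i; apply/QM/Qb.
Qed.

Lemma nzd_coefI Q g : nzd Q g -> nzd (coefI Q) g%:P.
Proof. by move=> nz f H n; apply: nz; have := H n; rewrite coefMC. Qed.

Lemma regular_seq_polyC (y : 'I_4 -> R) :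
  regular_seq y -> regular_seq (fun i => (y i)%:P).
Proof.
case=> y0 y1 y2 y3; split; first by rewrite polyC_eq0.
- exact: (nzd_ext (coefI_multiples _) (nzd_coefI y1)).
- exact: (nzd_ext (coefI_pair _ _) (nzd_coefI y2)).
- apply: (nzd_ext _ (nzd_coefI y3)) => f.
  apply: (iff_trans (coefI_adjoin _ _ _)); last exact: (adjoin_ext _ (coefI_pair _ _)).
  by case: (is_ideal_adjoin (y 1) (is_ideal_multiples (y 0))).
Qed.

(* McCoy: modulo [e], the leading coefficients of an annihilator of [g + f 'X]
   are killed by powers of [f], the trailing ones by powers of [g]. *)
Lemma nzd_generic (e f g : R) : e != 0 -> f != 0 -> nzd (multiples f) g ->
  nzd (multiples e%:P) (g%:P + f *: 'X).
Proof.
move=> e0 f0 nz a /coefI_multiples H; apply/coefI_multiples.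
have [Q0 QD QM] := is_ideal_multiples e; have QB := is_idealB (is_ideal_multiples e).
have cE n : (a * (g%:P + f *: 'X))`_n = a`_n * g + (if n is n'.+1 then a`_n' * f else 0).
  rewrite mulrDr coefD coefMC -mul_polyC mulrA coefMX coefMC.
  by case: n.
have F k n : (size a <= n + k)%N -> multiples e (a`_n * f ^+ k).
  elim: k n => [|k IH] n le_an; first by rewrite nth_default ?mul0r // -(addn0 n).
  have -> : a`_n * f ^+ k.+1 =
     f ^+ k * (a`_n.+1 * g + a`_n * f) - g * (a`_n.+1 * f ^+ k) by rewrite exprS; ring.
  by apply: QB; apply: QM; [rewrite -(cE n.+1); apply: H | apply: IH; rewrite addSnnS].
have G n : multiples e (a`_n * g ^+ n.+1).
  elim: n => [|n IH].
    by have := H 0%N; rewrite cE addr0 expr1.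
  have -> : a`_n.+1 * g ^+ n.+2 =
     g ^+ n.+1 * (a`_n.+1 * g + a`_n * f) - f * (a`_n * g ^+ n.+1) by rewrite 2!exprS; ring.
  by apply: QB; apply: QM => //; rewrite -(cE n.+1); apply: H.
move=> n; apply: (nzd_multiples_jointX e0 f0 nz (F (size a) n _) (G n)).
exact: leq_addl.
Qed.

Variable x : 'I_4 -> R.
Let xP i := (x i)%:P.

(** The [x i] are constants, so each coefficient of a section over the polynomial ring is a section
    over [R] and can be expanded there; the expansions are reassembled into polynomials. *)
Lemma spanned_polyC K I T : is_ideal I -> K 0 ->
  spanned x K I T -> spanned xP (coefI K) (coefI I) T.
Proof.
move=> idI K0 [n0 [s [ss Hs]]]; have [I0 ID IM] := idI.
exists n0, (fun p i => (s p i)%:P); split=> [p i j n|n u su].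
  by rewrite /xP -!polyC_exp -!polyCM -polyCB coefC; case: ifP => // _; apply: ss.
pose L := \max_i size (u i).
have sl (l : 'I_L.+1) : section x I n (fun i => (u i)`_l).
  by move=> i j; have := su i j l; rewrite /xP coefB -!polyC_exp !coefMC.
have [c' Hc'] := fin_all_exists (fun l => Hs _ _ (sl l)).
have [r Hr] := fin_all_exists Hc'; have [m Hm] := fin_all_exists Hr.
(* A single exponent that dominates the exponents [m l] of all coefficients. *)
pose M := \sum_l m l.
exists (fun p => \poly_(l < L.+1) c' (inord l) p), (\poly_(l < L.+1) r (inord l)), M.
split=> [p l|i l].
  by rewrite coef_poly; case: ifP => // _; case: (Hm (inord l)).
rewrite /xP -!polyC_exp coefMC !coefB !coefMC coef_sum.
under eq_bigr => p _ do rewrite coefMC coefMC coef_poly.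
rewrite coef_poly; case: ltnP => [l_lt|l_ge].
  have [_ /(_ i)] := Hm (inord l); rewrite inordK // => Hi.
  have -> : M = (m (inord l) + (M - m (inord l)))%N.
    by rewrite subnKC // /M (bigD1 (inord l)) //= leq_addr.
  by rewrite (exprD _ (m _)) mulrA [X in I X]mulrC; apply: IM.
rewrite nth_default; last by apply: leq_trans (ltnW l_ge); apply: (leq_bigmax i).
by rewrite !mul0r big1 ?subr0 ?mul0r // => p _; rewrite !mul0r.
Qed.

(** Specialization of the new variable to 0: constant terms are multiplicative, so the constant
    terms of the spanning family still span. *)
Lemma spanned_coef0 K I T : I 0 ->
  spanned xP (coefI K) (coefI I) T -> spanned x K I T.
Proof.
move=> I0 [n0 [s [ss Hs]]].
exists n0, (fun p i => (s p i)`_0); split=> [p i j|n u su].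
  by have := ss p i j 0%N; rewrite /xP coefB -!polyC_exp !coefMC.
have [|c [r [m [Kc Hc]]]] := Hs n (fun i => (u i)%:P).
  by move=> i j l; rewrite /xP -!polyC_exp -!polyCM -polyCB coefC; case: ifP => // _; apply: su.
exists (fun p => (c p)`_0), r`_0, m; split=> [p|i]; first exact: Kc.
have := Hc i 0%N; rewrite /xP -!polyC_exp coefMC !coefB !coefMC coefC eqxx coef_sum.
by under eq_bigr => p _ do rewrite coefMC coef0M.
Qed.

Lemma spanned_link K J T (f g f' g' : R) :
  (forall n, regular_seq (fun i => x i ^+ n)) -> K 0 -> is_ideal J ->
  J f -> J g -> J f' -> J g' ->
  f != 0 -> f' != 0 -> nzd (multiples f) g -> nzd (multiples f') g' ->
  spanned x K (colon (adjoin (multiples f) g) J) T ->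
  spanned x K (colon (adjoin (multiples f') g') J) T.
Proof.
move=> reg K0 idJ Jf Jg Jf' Jg' f0 f0' nz nz' sp.
have [J0 _ _] := idJ.
have idP (a b : R) : is_ideal (adjoin (multiples a) b).
  exact/is_ideal_adjoin/is_ideal_multiples.
have idPP (a b : {poly R}) : is_ideal (adjoin (multiples a) b).
  exact/is_ideal_adjoin/is_ideal_multiples.
have JP a : J a -> coefI J a%:P by move=> Ja n; rewrite coefC; case: ifP.
have idJP := is_ideal_coefI idJ; have [JP0 JPD JPM] := idJP.
pose h := g%:P + f *: 'X.
have Jh : coefI J h.
  by apply: JPD; rewrite -?mul_polyC 1?mulrC; [apply: JP | apply/JPM/JP].
have regP n : regular_seq (fun i => xP i ^+ n).
  have [] := regular_seq_polyC (reg n).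
  by rewrite /xP !polyC_exp; split.
have h0 : h != 0.
  apply/eqP => /polyP /(_ 1%N); rewrite coef0 coefD coefC coefZ coefX /= add0r mulr1.
  exact/eqP.
have fP0 : f%:P != 0 by rewrite polyC_eq0.
have fP0' : f'%:P != 0 by rewrite polyC_eq0.
(* Genericity of [h]: it forms a regular sequence with [f] and with [f'], although the two given
   pairs are unrelated. *)
have hf : nzd (multiples h) f%:P by apply: nzd_multiplesC => //; apply: nzd_generic.
have fh' : nzd (multiples f'%:P) h by apply: nzd_generic.
have hf' : nzd (multiples h) f'%:P by apply: nzd_multiplesC.
have fg' : nzd (multiples f'%:P) g'%:P.
  exact: (nzd_ext (coefI_multiples _) (nzd_coefI nz')).
have colonE a b F : coefI (colon (adjoin (multiples a) b) J) F <->
     colon (adjoin (multiples a%:P) b%:P) (coefI J) F.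
  by apply: (iff_trans (coefI_colon _ _ _)) => //; apply: colon_ext => // k; apply: coefI_pair.
apply: spanned_coef0; first by case: (is_ideal_colon J (idP f' g')).
apply: (@spanned_ext _ _ _ _ _ _ (fun F => iff_sym (colonE f' g' F))).
have kos a b n : a != 0 -> nzd (multiples a) b -> _ := @koszul_regular_quot _ _ a b (regP n).
(* Last move of the chain, read backwards: [f'] is shared and [h] is exchanged for [g']. *)
apply: (spanned_swap (is_ideal_multiples _) Jh (JP _ Jg') fh' fg');
  [by move=> n; case: (kos _ _ n fP0' fh') | by move=> n; case: (kos _ _ n fP0' fh')
  | by move=> n; case: (kos _ _ n fP0' fg') |].
have swapE a b F : colon (adjoin (multiples a) b) (coefI J) F <->
     colon (adjoin (multiples b) a) (coefI J) F.
  by apply: colon_ext => // k; split; apply: pairC.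
apply: (spanned_ext (swapE _ _)).
(* The move before it: [h] is shared and [f] is exchanged for [f']. *)
apply: (spanned_swap (is_ideal_multiples _) (JP _ Jf) (JP _ Jf') hf hf');
  [by move=> n; case: (kos _ _ n h0 hf) | by move=> n; case: (kos _ _ n h0 hf)
  | by move=> n; case: (kos _ _ n h0 hf') |].
apply: (spanned_ext (swapE _ _)).
have -> : h = g%:P + 'X * f%:P by rewrite /h -mul_polyC mulrC.
(* [h] and [g] agree modulo [f], so the two pairs generate the same ideal. *)
apply: (@spanned_ext _ _ _ (colon (adjoin (multiples f%:P) g%:P) (coefI J))).
  apply: colon_ext => // F; split=> -[a /multiplesP [b Hb]]; exists a; apply/multiplesP.
    by exists (b - a * 'X); rewrite mulrBl -Hb; ring.
  by exists (b + a * 'X); rewrite mulrDl -Hb; ring.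
apply: (spanned_ext (colonE f g)); apply: spanned_polyC => //.
exact: is_ideal_colon.
Qed.

End PolyLift.

(** * Monomial ideals and linkage in four variables *)

Section MonomialIdeals.
Variables (n : nat) (k : fieldType).
Implicit Types (P : pred 'X_{1..n}) (f g : {mpoly k[n]}) (m a : 'X_{1..n}).

Definition up_closed P := forall m a, P m -> P (m + a)%MM.

Definition mono P f := forall m, ~~ P m -> f@_m = 0.

Lemma monoP P f m : mono P f -> f@_m != 0 -> P m.
Proof. by move=> H nz; apply: contraNT nz => /H ->. Qed.

Lemma monoM P P' P'' f g : (forall m a, P m -> P' a -> P'' (m + a)%MM) ->
  mono P f -> mono P' g -> mono P'' (f * g).
Proof.
move=> PP Pf Pg m; apply: contraNeq; rewrite -mcoeff_msupp => /msuppM_le.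
case/allpairsP=> -[a b] /= [Ha Hb ->]; apply: PP.
  by apply: (monoP Pf); rewrite -mcoeff_msupp.
by apply: (monoP Pg); rewrite -mcoeff_msupp.
Qed.

Lemma mono_mpolyX P m : mono P 'X_[m] <-> P m.
Proof.
split=> [/(@monoP _ _ m)|Pm a]; first by rewrite mcoeffX eqxx oner_eq0; apply.
by rewrite mcoeffX; case: eqP => // <-; rewrite Pm.
Qed.

Lemma is_ideal_mono P : up_closed P -> is_ideal (mono P).
Proof.
move=> upP; split=> [m _|f g Pf Pg m Pm|f g Pg].
- by rewrite mcoeff0.
- by rewrite mcoeffD Pf ?Pg ?addr0.
- apply: (@monoM predT P) => // m a _ Pa.
  by rewrite addmC; apply: upP.
Qed.

Lemma mcoeffMX_if f a m :
  (f * 'X_[a])@_m = if (a <= m)%MM then f@_(m - a)%MM else 0.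
Proof.
case: ifPn => [le_am|nle_am].
  by rewrite -{1}(submK le_am) addmC mcoeffMX.
have := @mono_mpolyX (fun m => (a <= m)%MM) a => -[_ H].
apply: (@monoM predT (fun m => (a <= m)%MM) (fun m => (a <= m)%MM) f 'X_[a]) => //.
  by move=> b c _ le_ac; apply: lepm_trans le_ac (lem_addl _ _).
by apply: H; apply: lepm_refl.
Qed.

Lemma mpoly_choice (P : 'X_{1..n} -> k -> Prop) b :
  (forall m, exists c, P m c) -> (forall m, (b <= mdeg m)%N -> P m 0) ->
  exists g : {mpoly k[n]}, forall m, P m g@_m.
Proof.
move=> Pex P0; have [c Hc] := fin_all_exists (fun m : 'X_{1..n < b} => Pex m).
pose E (m : 'X_{1..n}) := if insub m is Some m' then c m' else 0.
exists (\sum_(m : 'X_{1..n < b}) E m *: 'X_[m]) => m.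
case: (ltnP (mdeg m) b) => [lt_m|ge_m].
  by rewrite (mcoeff_mpoly E) // /E insubT; apply: (Hc (Sub m lt_m)).
rewrite raddf_sum big1 /= => [|a _]; first exact: P0.
rewrite mcoeffZ mcoeffX; case: eqP => [eq_am|]; rewrite ?mulr0 //.
by have := bmdeg a; rewrite eq_am ltnNge ge_m.
Qed.

Lemma mpoly_shift f a : exists g : {mpoly k[n]}, forall m, g@_m = f@_(m + a)%MM.
Proof.
apply: (@mpoly_choice (fun m c => c = f@_(m + a)%MM) (msize f)) => [m|m ge_m].
  by exists f@_(m + a)%MM.
rewrite memN_msupp_eq0 //; apply: msize_mdeg_ge.
by rewrite mdegD (leq_trans ge_m) // leq_addr.
Qed.

Lemma adjoin_mono P Q a f : (forall g, Q g <-> mono P g) ->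
  adjoin Q 'X_[a] f <-> mono (fun m => P m || (a <= m)%MM) f.
Proof.
move=> QP; split=> [[g /QP H] m|H].
  rewrite negb_or => /andP [/H Hm /negPf nle_am].
  by move: Hm; rewrite mcoeffB mcoeffMX_if nle_am subr0.
(* The quotient [g] collects all terms of [f] divisible by the monomial, so none of them survives in
   the difference. *)
have [g Hg] := mpoly_shift f a; exists g; apply/QP => m Pm.
rewrite mcoeffB mcoeffMX_if Hg; case: ifPn => [le_am|nle_am].
  by rewrite submK ?subrr.
by rewrite H ?subr0 // negb_or Pm.
Qed.

Lemma nzd_mono P Q a : (forall g, Q g <-> mono P g) ->
  (forall m, P (m + a)%MM -> P m) -> nzd Q 'X_[a].
Proof.
move=> QP Pa f /QP H; apply/QP => m Pm.
have := H (m + a)%MM; rewrite mcoeffMX_if lem_addl addmK; apply.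
by apply: contra Pm; apply: Pa.
Qed.

End MonomialIdeals.

Lemma ord4_ind (P : 'I_4 -> Prop) : P 0 -> P 1 -> P 2%:R -> P 3%:R -> forall i, P i.
Proof.
move=> P0 P1 P2 P3 [[|[|[|[|//]]]] lt_i].
- by rewrite (_ : Ordinal lt_i = 0) //; apply: val_inj.
- by rewrite (_ : Ordinal lt_i = 1) //; apply: val_inj.
- by rewrite (_ : Ordinal lt_i = 2%:R) //; apply: val_inj.
- by rewrite (_ : Ordinal lt_i = 3%:R) //; apply: val_inj.
Qed.

Lemma le_expU n p (i : 'I_n) (m : 'X_{1..n}) : (U_(i) *+ p <= m)%MM = (p <= m i)%N.
Proof.
apply/mnm_lepP/idP => [/(_ i)|le_pm j]; rewrite mulmnE mnm1E ?eqxx ?mul1n //.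
by case: eqP => [<-|]; rewrite ?mul1n ?mul0n.
Qed.

(** * Linkage in four variables *)

Section Linkage.
Variable k : fieldType.
Local Notation R := {mpoly k[4]}.

Definition vars (i : 'I_4) : R := 'X_i.
Definition constants (f : R) := exists c, f = c%:MP.

Lemma vars_exp i p : vars i ^+ p = 'X_[U_(i) *+ p].
Proof. exact: mpolyXn. Qed.

(** Membership in the ideal of the earlier powers depends only on the exponents of the earlier
    variables, which the next power leaves alone. Powers occur because sections have denominators
    [x i ^+ n]. *)
Lemma regular_seq_vars p : regular_seq (fun i => vars i ^+ p).
Proof.
have E0 g : @zeroI R g <-> mono (fun=> false) g.
  split=> [-> m _|H]; first by rewrite mcoeff0.
  by apply/mpolyP => m; rewrite mcoeff0 H.
have E1 g := adjoin_mono (U_(0) *+ p) g E0.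
have E2 g := adjoin_mono (U_(1) *+ p) g E1.
have E3 g := adjoin_mono (U_(2%:R) *+ p) g E2.
rewrite /regular_seq /multiples !vars_exp; split.
- by rewrite -msupp_eq0 msuppX.
- by apply: (nzd_mono E1) => m; rewrite !le_expU mnmDE mulmnE mnm1E addn0.
- by apply: (nzd_mono E2) => m; rewrite !le_expU !mnmDE !mulmnE !mnm1E !addn0.
- by apply: (nzd_mono E3) => m; rewrite !le_expU !mnmDE !mulmnE !mnm1E !addn0.
Qed.

Lemma is_ideal_span (S : R -> Prop) : is_ideal (ideal_span S).
Proof.
split.
- by exists 0%N, (fun=> 0), (fun=> 0); split=> [[]//|]; rewrite big_ord0.
- move=> _ _ [n [r [s [Ss ->]]]] [n' [r' [s' [Ss' ->]]]].
  pose cat (u : 'I_n -> R) (u' : 'I_n' -> R) i :=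
    match split i with inl j => u j | inr j => u' j end.
  exists (n + n')%N, (cat r r'), (cat s s'); split=> [i|].
    by rewrite /cat; case: split.
  rewrite big_split_ord; congr (_ + _); apply: eq_bigr => i _; rewrite /cat.
    by rewrite -[lshift _ _]/(unsplit (inl i)) unsplitK.
  by rewrite -[rshift _ _]/(unsplit (inr i)) unsplitK.
- move=> a _ [n [r [s [Ss ->]]]]; exists n, (fun i => a * r i), s; split=> //.
  by rewrite mulr_sumr; apply: eq_bigr => i _; rewrite mulrA.
Qed.

Lemma span_gen (S : R -> Prop) f : S f -> ideal_span S f.
Proof.
move=> Sf; exists 1%N, (fun=> 1), (fun=> f); split=> //.
by rewrite big_ord1 mul1r.
Qed.

Lemma span_min (S Q : R -> Prop) f : is_ideal Q -> (forall g, S g -> Q g) ->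
  ideal_span S f -> Q f.
Proof.
move=> idQ SQ [n [r [s [Ss ->]]]]; apply: is_ideal_sum => // i.
by case: idQ => _ _; apply; apply: SQ.
Qed.

Lemma principalE (f g : R) : principal f g <-> multiples f g.
Proof.
split=> [|/multiplesP [a ->]].
  by apply: span_min (is_ideal_multiples f) _ => _ ->; apply/multiplesP; exists 1; rewrite mul1r.
by have [_ _ QM] := is_ideal_span (fun h => h = f); apply/QM/span_gen.
Qed.

Lemma span_pairE (f g h : R) :
  ideal_span (fun h => h = f \/ h = g) h <-> adjoin (multiples f) g h.
Proof.
have idP := is_ideal_adjoin g (is_ideal_multiples f); have [P0 PD PM] := idP.
have [_ QD QM] := is_ideal_span (fun h => h = f \/ h = g).
split=> [|[b /multiplesP [a Hab]]].
  apply: span_min idP _ => _ [->|->].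
    by exists 0; rewrite mul0r subr0; apply/multiplesP; exists 1; rewrite mul1r.
  by exists 1; rewrite mul1r subrr; have [] := is_ideal_multiples f.
rewrite -(subrK (b * g) h) Hab; apply: QD; apply/QM/span_gen; tauto.
Qed.

Lemma CI_idealE (X : R -> Prop) : CI_ideal X -> exists F G,
  [/\ F != 0, nzd (multiples F) G & forall f, X f <-> adjoin (multiples F) G f].
Proof.
case=> F [G [_ [_ [_ [_ [_ [_ [F0 [nz XE]]]]]]]]]; exists F, G; split=> //.
  exact: nzd_ext (principalE F) nz.
by move=> f; apply: (iff_trans (XE f) (span_pairE F G f)).
Qed.

(** The middle ideal [J] contains both complete intersections, and [I] and [I'] are its residuals in
    them, so [spanned_link] applies to [J]. *)
Lemma spanned_double_link T (I J I' : R -> Prop) :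
  directly_linked I J -> directly_linked J I' ->
  spanned vars constants I T -> spanned vars constants I' T.
Proof.
case=> X [/CI_idealE [f [g [f0 nz XE]]] [Xsub [IJ JI]]].
case=> X' [/CI_idealE [f' [g' [f0' nz' XE']]] [Xsub' [JI' _]]] sp.
have idX : is_ideal (adjoin (multiples f) g) by apply/is_ideal_adjoin/is_ideal_multiples.
have JE h : J h <-> colon (adjoin (multiples f) g) I h.
  by apply: (iff_trans (iff_sym (IJ h))); apply: colon_ext.
have idJ : is_ideal J.
  have [Q0 QD QM] := is_ideal_colon I idX.
  by split=> [|a b /JE Ja /JE Jb|a b /JE Jb]; apply/JE; [|apply: QD|apply: QM].
have Jgen F G Y : (forall h, Y h <-> adjoin (multiples F) G h) ->
    (forall h, Y h -> J h) -> J F /\ J G.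
  move=> YE YJ; split; apply/YJ/YE/span_pairE/span_gen; tauto.
have [Jf Jg] := Jgen _ _ _ XE (fun h Xh => (Xsub h Xh).2).
have [Jf' Jg'] := Jgen _ _ _ XE' (fun h Xh => (Xsub' h Xh).1).
apply: (@spanned_ext _ _ _ (colon (adjoin (multiples f') g') J)).
  by move=> h; apply: iff_trans (JI' h); apply: colon_ext => // F; apply: iff_sym.
apply: (spanned_link regular_seq_vars _ idJ Jf Jg Jf' Jg' f0 f0' nz nz').
  by exists 0; rewrite mpolyC0.
apply: spanned_ext sp => h; apply: iff_trans (iff_sym (JI h)) _.
exact: colon_ext.
Qed.

Lemma directly_linked_sym (I J : R -> Prop) : directly_linked I J -> directly_linked J I.
Proof.
case=> X [CI [sub [IJ JI]]]; exists X; split=> //; split=> [f /sub [] //|].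
by split.
Qed.

Lemma evenly_linked_sym (I J : R -> Prop) : evenly_linked I J -> evenly_linked J I.
Proof.
case=> m [s [s0 [sm sl]]]; exists m, (fun i => s (2 * m - i)%N).
rewrite subn0 subnn; split=> //; split=> // i lt_i.
apply: directly_linked_sym.
have -> : (2 * m - i = (2 * m - i.+1).+1)%N by lia.
by apply: sl; lia.
Qed.

Lemma spanned_evenly_linked T (I J : R -> Prop) : evenly_linked I J ->
  spanned vars constants I T -> spanned vars constants J T.
Proof.
case=> m [s [s0 [sm sl]]] spI; apply: (spanned_ext sm).
have sp0 : spanned vars constants (s 0%N) T.
  by apply: spanned_ext spI => f; apply: iff_sym (s0 f).
elim: m {sm} sl => [|m IH] sl; first by rewrite muln0.
have -> : (2 * m.+1 = (2 * m).+2)%N by lia.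
apply: (spanned_double_link (sl (2 * m)%N _) (sl (2 * m).+1 _)); [lia | lia |].
by apply: IH => i lt_i; apply: sl; lia.
Qed.

End Linkage.

(** * Tetrahedral ideals *)

(** The multiplicities as a symmetric function on the edges of the tetrahedron; the value 0 on the
    diagonal makes the condition in [heavy] void there. *)
Definition weight (t : 6.-tuple nat) (i j : 'I_4) : nat :=
  match val i, val j with
  | 0, 1 | 1, 0 => tnth t 0%R
  | 0, 2 | 2, 0 => tnth t 1%R
  | 0, 3 | 3, 0 => tnth t 2%:R%R
  | 1, 2 | 2, 1 => tnth t 3%:R%R
  | 1, 3 | 3, 1 => tnth t 4%:R%R
  | 2, 3 | 3, 2 => tnth t 5%:R%R
  | _, _ => 0
  end%N.

Definition heavy (w : 'I_4 -> 'I_4 -> nat) (m : 'X_{1..4}) :=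
  [forall i, forall j, w i j <= m i + m j]%N.

Lemma heavyP w (m : 'X_{1..4}) : reflect (forall i j, w i j <= m i + m j)%N (heavy w m).
Proof.
apply: (iffP forallP) => [H i j|H i]; last by apply/forallP.
exact: (forallP (H i)).
Qed.

Lemma up_closed_heavy w : up_closed (heavy w).
Proof.
move=> m a /heavyP H; apply/heavyP => i j; rewrite !mnmDE.
by have := H i j; lia.
Qed.

Section Tetrahedral.
Variable k : fieldType.
Local Notation R := {mpoly k[4]}.

Definition product_of (I : R -> Prop) a (f : R) :=
  exists s : 'I_a -> R, (forall i, I (s i)) /\ f = \prod_(i < a) s i.

Lemma product_ofS I a f g : I f -> product_of I a g -> product_of I a.+1 (f * g).
Proof.
move=> If [s [Is ->]]; exists (fun i => if unlift ord0 i is Some j then s j else f).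
split=> [i|]; first by case: unliftP.
rewrite big_ord_recl unlift_none; congr (_ * _).
by apply: eq_bigr => i _; rewrite liftK.
Qed.

Lemma mono_span (S : R -> Prop) (P : pred 'X_{1..4}) f :
  (forall m, P m -> ideal_span S 'X_[m]) -> mono P f -> ideal_span S f.
Proof.
move=> SP Pf; have [Q0 QD QM] := is_ideal_span S.
rewrite [f]mpolyE big_seq; elim/big_ind: _ => // m; rewrite mcoeff_msupp => /(monoP Pf) Pm.
by rewrite -mul_mpolyC; apply/QM/SP.
Qed.

Lemma ideal_powE (i j : 'I_4) a (f : R) : i != j ->
  ideal_pow (var_ideal2 i j) a f <-> mono (fun m => a <= m i + m j)%N f.
Proof.
move=> ne_ij; pose P b (m : 'X_{1..4}) := (b <= m i + m j)%N.
have idP b : is_ideal (@mono 4 k (P b)).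
  by apply: is_ideal_mono => m c; rewrite /P !mnmDE; lia.
have P1 (g : R) : var_ideal2 i j g -> mono (P 1%N) g.
  apply: span_min (idP _) _ => _ [->|->]; apply/mono_mpolyX.
    by rewrite /P mnm1E eqxx.
  by rewrite /P !mnm1E eqxx addn1.
split.
  apply: span_min (idP a) _ => _ [s [/(_ _)/P1 Hs ->]].
  elim: a s Hs => [|a IH] s Hs; first by move=> m; rewrite /P leq0n.
  rewrite big_ord_recl; apply: (@monoM _ _ (P 1%N) (P a)) => [m c|//|].
    by rewrite /P !mnmDE; lia.
  by apply: IH.
apply: mono_span => m le_a.
have prod b c : product_of (var_ideal2 i j) (b + c) ('X_i ^+ b * 'X_j ^+ c).
  elim: b => [|b IH]; last first.
    by rewrite exprS -mulrA; apply: product_ofS => //; apply: span_gen; left.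
  rewrite mul1r; elim: c => [|c IH]; first by exists (fun=> 0); rewrite big_ord0; split=> [[]|].
  by rewrite exprS; apply: product_ofS => //; apply: span_gen; right.
(* Take as many of the [a] factors as possible from the variable [i] and the rest from [j]. *)
pose b := minn a (m i); pose c := (a - b)%N.
have le_m : (U_(i) *+ b + U_(j) *+ c <= m)%MM.
  apply/mnm_lepP => l; rewrite mnmDE !mulmnE !mnm1E /b /c.
  case: (i =P l) => [<-|_]; first by rewrite (eq_sym j) (negPf ne_ij); lia.
  by case: (j =P l) => [<-|_]; lia.
have [_ _ QM] := is_ideal_span (product_of (var_ideal2 i j) a).
rewrite -(submK le_m) mpolyXD; apply/QM/span_gen.
rewrite mpolyXD -!mpolyXn; have -> : a = (b + c)%N by rewrite /b /c; lia.
exact: prod.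
Qed.

Lemma tetrahedralE t (f : R) : tetrahedral t f <-> mono (heavy (weight t)) f.
Proof.
rewrite /tetrahedral /ideal_cap !ideal_powE //; split=> [H m|H].
  case/forallPn => i /forallPn [j]; rewrite -ltnNge => lt_ij.
  case: H => [H1 [H2 [H3 [H4 [H5 H6]]]]].
  move: i j lt_ij; apply: ord4_ind; apply: ord4_ind; rewrite /weight //= => lt_w;
    solve [by apply: H1; rewrite -ltnNge; lia | by apply: H2; rewrite -ltnNge; lia
          | by apply: H3; rewrite -ltnNge; lia | by apply: H4; rewrite -ltnNge; lia
          | by apply: H5; rewrite -ltnNge; lia | by apply: H6; rewrite -ltnNge; lia].
have sub i j : mono (fun m => weight t i j <= m i + m j)%N f.
  by move=> m lt_w; apply: H; apply: contra lt_w => /heavyP.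
by do ![split]; apply: sub.
Qed.

End Tetrahedral.

(** * Vanishing deficiency module *)

Lemma weight_diag t i : weight t i i = 0%N.
Proof. by move: i; apply: ord4_ind. Qed.

Lemma weightC t i j : weight t i j = weight t j i.
Proof. by move: i j; apply: ord4_ind; apply: ord4_ind. Qed.

Lemma avoid2 (i j : 'I_4) : exists l : 'I_4, (l != i) && (l != j).
Proof.
by move: i j; do 2![apply: ord4_ind]; do [by exists 0 | by exists 1 | by exists 2%:R].
Qed.

Lemma avoid3 (i j h : 'I_4) : exists l : 'I_4, [&& l != i, l != j & l != h].
Proof.
by move: i j h; do 3![apply: ord4_ind];
  do [by exists 0 | by exists 1 | by exists 2%:R | by exists 3%:R].
Qed.

Section NonzerodivisorsACM.
Variables (k : fieldType) (w : 'I_4 -> 'I_4 -> nat).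
Hypothesis w0 : forall i, w i i = 0%N.
Local Notation R := {mpoly k[4]}.
Local Notation I := (@mono 4 k (heavy w)).

Definition wmax := \max_i \max_j w i j.

Lemma le_wmax i j : (w i j <= wmax)%N.
Proof.
exact: leq_trans (leq_bigmax j) (leq_bigmax (F := fun i => \max_j w i j) i).
Qed.

Let idI : is_ideal I := is_ideal_mono k (@up_closed_heavy w).

(** An edge where [m] falls short of the weight still does so after a shift along a vertex [l] off
    that edge. *)
Lemma mono_heavy_sat p (f : R) : (forall i, I (f * vars k i ^+ p)) -> I f.
Proof.
move=> H m /forallPn [i /forallPn [j]]; rewrite -ltnNge => lt_ij.
have [l /andP [li lj]] := avoid2 i j.
have := H l (m + U_(l) *+ p)%MM; rewrite vars_exp mcoeffMX_if lem_addl addmK; apply.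
apply/forallPn; exists i; apply/forallPn; exists j.
by rewrite !mnmDE !mulmnE !mnm1E (negPf li) (negPf lj) !mul0n !addn0 -ltnNge.
Qed.

Definition sym1 : R := \sum_i vars k i.

Lemma nzd_sym1 : nzd I sym1.
Proof.
move=> f H m /forallPn [i /forallPn [j]]; rewrite -ltnNge => lt_ij; apply/eqP/negPn/negP.
have [l /andP [li lj]] := avoid2 i j.
(* Infinite descent: if [f] has a nonzero coefficient at [m], the vanishing coefficient of
   [f * sym1] at [m + U_(l)] forces another one, where either [m i + m j] is smaller or that sum is
   the same and [m l] is larger. The exponent at [l] is bounded, so this lexicographic measure
   drops. *)
pose mu (m : 'X_{1..4}) := ((m i + m j) * (msize f).+1 + (msize f - m l))%N.
have le_l a : f@_a != 0 -> (a l < msize f)%N.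
  rewrite -mcoeff_msupp => /msize_mdeg_lt; apply: leq_ltn_trans.
  by rewrite mdegE (bigD1 l) //= leq_addr.
have [N] := ubnP (mu m); elim: N m lt_ij => // N IH m lt_ij lt_mu nz.
have ne_ij : i != j by apply: contraTneq lt_ij => ->; rewrite w0.
have : (f * sym1)@_(m + U_(l))%MM = 0.
  apply: H; apply/forallPn; exists i; apply/forallPn; exists j.
  by rewrite !mnmDE !mnm1E (negPf li) (negPf lj) !addn0 -ltnNge.
rewrite mulr_sumr raddf_sum (bigD1 l) //= /vars mcoeffMX_if lem_addl addmK big1 ?addr0.
  exact/eqP.
move=> v ne_vl; rewrite mcoeffMX_if lep1mP mnmDE mnm1E (eq_sym l) (negPf ne_vl) addn0.
case: ifP => // mv; apply/eqP; apply: contraTT isT => nz'.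
have El h : (m + U_(l) - U_(v))%MM h = (m h + (l == h) - (v == h))%N.
  by rewrite mnmBE mnmDE !mnm1E.
have lt_l := le_l _ nz; have := le_l _ nz'; rewrite El eqxx (negPf ne_vl) => lt_l'.
case: (IH _ _ _ nz'); first by rewrite !El (negPf li) (negPf lj); lia.
rewrite /mu in lt_mu *; rewrite !El (negPf li) (negPf lj) eqxx (negPf ne_vl).
case: (v =P i) mv => [->|_] mv; first by rewrite (negPf ne_ij); nia.
by case: (v =P j) mv => [->|_] mv; nia.
Qed.

Local Notation x := (vars k).

(** The second elementary symmetric polynomial. *)
Definition sym2 : R :=
  (x 1 + x 2%:R + x 3%:R) * x 0 + (x 2%:R + x 3%:R) * x 1 + x 2%:R * x 3%:R.

Lemma irrelevant_var i : irrelevant (x i).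
Proof. by apply: span_gen; exists i. Qed.

Lemma irrelevant_sym1 : irrelevant sym1.
Proof. by apply: is_ideal_sum irrelevant_var; apply: is_ideal_span. Qed.

Lemma irrelevant_sym2 : irrelevant sym2.
Proof.
have [_ QD QM] := is_ideal_span (fun f : R => exists i, f = 'X_i).
have Qv := irrelevant_var.
by apply: (QD); [apply: (QD)|]; apply: (QM); apply: Qv.
Qed.

Let square_free (m : 'X_{1..4}) := heavy (fun i j => i != j : nat) m.

(* Vieta: [x i ^ 4 = e1 x i ^ 3 - e2 x i ^ 2 + e3 x i - e4], and [e3], [e4] lie
   in the ideals of all six lines. *)
Lemma var_pow4 i : exists a b c : R,
  x i ^+ 4 = a * sym1 + b * sym2 + c /\ mono square_free c.
Proof.
pose e3 : R := x 0 * x 1 * x 2%:R + x 0 * x 1 * x 3%:R + x 0 * x 2%:R * x 3%:R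
  + x 1 * x 2%:R * x 3%:R.
exists (x i ^+ 3), (- x i ^+ 2), (e3 * x i - x 0 * x 1 * x 2%:R * x 3%:R); split.
  have -> : sym1 = x 0 + x 1 + x 2%:R + x 3%:R.
    rewrite /sym1 !big_ord_recl big_ord0 addr0 !addrA.
    by do 3![congr (_ + _)]; congr x; apply: val_inj.
  by move: i; apply: ord4_ind; rewrite /sym2 /e3; ring.
have idQ : is_ideal (@mono 4 k square_free) by apply/is_ideal_mono/up_closed_heavy.
have [_ QD QM] := idQ.
have tri a b c : (forall i j, (i != j <= (a == i) + (b == i) + (c == i)
     + ((a == j) + (b == j) + (c == j)))%N) -> mono square_free (x a * x b * x c).
  move=> H; rewrite /vars -!mpolyXD; apply/mono_mpolyX/heavyP => p q.
  by rewrite !mnmDE !mnm1E.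
apply: (is_idealB idQ); last by rewrite mulrC; apply/QM/tri; do 2![apply: ord4_ind].
by rewrite mulrC /e3; apply/QM; apply: (QD); [apply: (QD); [apply: (QD)|]|]; apply: (tri); do 2![apply: ord4_ind].
Qed.

(** Modulo [sym1] and [sym2], powers of [x i ^+ 4] are powers of [c]. Each factor [c] contributes 1
    on every edge, so [wmax] factors meet all weights. *)
Lemma var_pow_heavy : exists p, forall i, exists a b c : R,
  x i ^+ p = a * sym1 + b * sym2 + c /\ I c.
Proof.
exists (4 * wmax)%N => i; have [a [b [c [E Hc]]]] := var_pow4 i.
have Hp p : mono (heavy (fun i j => p * (i != j))%N) (c ^+ p).
  elim: p => [m|p IH]; first by case/forallPn=> u /forallPn [v]; rewrite mul0n leq0n.
  rewrite exprS; apply: monoM _ Hc IH => m m' /heavyP H /heavyP H'.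
  by apply/heavyP => u v; rewrite !mnmDE mulSn; have := H u v; have := H' u v; lia.
have Ep p : exists a' b', x i ^+ (4 * p) = a' * sym1 + b' * sym2 + c ^+ p.
  elim: p => [|p [a' [b' E']]]; first by exists 0, 0; rewrite !mul0r !add0r.
  exists (a * x i ^+ (4 * p) + c * a'), (b * x i ^+ (4 * p) + c * b').
  by rewrite mulnS exprD {1}E {2 3}E' exprS; rewrite E'; ring.
have [a' [b' E']] := Ep wmax.
exists a', b', (c ^+ wmax); split=> // m Im; apply: (Hp wmax); apply: contra Im.
move=> /heavyP H; apply/heavyP => u v; apply: leq_trans (H u v).
by case: eqP => [->|_]; rewrite ?w0 // muln1 le_wmax.
Qed.

(** If h e2 = l e1 modulo the ideal, then a_i h + b_i l, divided by x_i^p, represents h/e1 on each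
    chart. This section is global because the deficiency module vanishes, so [h] is a multiple of
    e1. *)
Lemma nzd_mod_sym2 (T : finType) : (T -> False) -> spanned x (@constants k) I T ->
  nzd (adjoin I sym1) sym2.
Proof.
move=> noT [n0 [s [_ Hs]]] h [l Hl]; have [_ ID IM] := idI.
have IB := is_idealB idI; have nz1 := nzd_sym1.
have [p /fin_all_exists [a /fin_all_exists [b /fin_all_exists [c Hc]]]] := var_pow_heavy.
pose u i := a i * h + b i * l.
have uE i : I (u i * sym1 - h * x i ^+ p).
  have [-> Ic] := Hc i.
  have -> : u i * sym1 - h * (a i * sym1 + b i * sym2 + c i) =
    0 - b i * (h * sym2 - l * sym1) - h * c i by rewrite /u; ring.
  by apply: (IB); [apply: (IB); [by case: idI|]|]; apply: (IM).
have [|d [r [m [_ Hr]]]] := Hs p u.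
  move=> i j; apply: nz1.
  have -> : (u i * x j ^+ p - u j * x i ^+ p) * sym1 =
    x j ^+ p * (u i * sym1 - h * x i ^+ p) - x i ^+ p * (u j * sym1 - h * x j ^+ p) by ring.
  by apply: (IB); apply: (IM).
exists r; apply: (@mono_heavy_sat (p + n0 + m)) => i.
have -> : (h - r * sym1) * x i ^+ (p + n0 + m) =
  sym1 * ((u i * x i ^+ n0 - 0 - r * x i ^+ (p + n0)) * x i ^+ m)
  - x i ^+ (n0 + m) * (u i * sym1 - h * x i ^+ p) by rewrite !exprD; ring.
apply: (IB); apply: (IM) => //.
by have := Hr i; rewrite big1 // => q; case: (noT q).
Qed.

End NonzerodivisorsACM.

Lemma ACM_of_spanned (k : fieldType) (t : 6.-tuple nat) (T : finType) : (T -> False) ->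
  spanned (vars k) (@constants k) (tetrahedral t) T -> ACM (@tetrahedral k t).
Proof.
move=> noT sp; right; exists (sym1 k), (sym2 k).
have w0 := weight_diag t; have tE := @tetrahedralE k t.
split; first exact: irrelevant_sym1.
split; first exact: irrelevant_sym2.
split; first by apply: nzd_ext (nzd_sym1 w0) => f; apply: iff_sym.
apply: nzd_ext (nzd_mod_sym2 w0 noT (spanned_ext tE sp)) => f.
split=> [[a Ha]|[g [_ [/tE Ig [/principalE/multiplesP [a ->] ->]]]]].
  exists (f - a * sym1 k), (a * sym1 k); rewrite subrK; split; first exact/tE.
  by split=> //; apply/principalE/multiplesP; exists a.
by exists a; rewrite addrK.
Qed.

(** * Deficiency modules of tetrahedral curves *)

Section BadDegrees.
Variable w : 'I_4 -> 'I_4 -> nat.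
Implicit Types (m a : 'X_{1..4}).

Definition gap m i j := (m i + m j < w i j)%N.

Definition opposite_gaps i j h l m :=
  [&& gap m i j, gap m h l, ~~ gap m i h, ~~ gap m i l, ~~ gap m j h & ~~ gap m j l].

Definition bad m := [|| opposite_gaps 0 1 2%:R 3%:R m,
  opposite_gaps 0 2%:R 1 3%:R m | opposite_gaps 0 3%:R 1 2%:R m].

(* For a bad [m], the surviving lines are two disjoint edges of the tetrahedron;
   this selects the vertices of the one that misses the vertex [0]. *)
Definition away m i := (i != 0) && ~~ gap m 0 i.

End BadDegrees.

Lemma uniq4_cover (i j h l v : 'I_4) : uniq [:: i; j; h; l] -> v \in [:: i; j; h; l].
Proof.
move=> un; have sub : {subset [:: i; j; h; l] <= enum 'I_4} by move=> y _; rewrite mem_enum.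
have [|_ ->] := uniq_min_size un sub; first by rewrite size_enum_ord.
by rewrite mem_enum.
Qed.

Section Deficiency.
Variables (k : fieldType) (w : 'I_4 -> 'I_4 -> nat).
Hypotheses (w0 : forall i, w i i = 0%N) (wC : forall i j, w i j = w j i).
Local Notation R := {mpoly k[4]}.
Local Notation I := (@mono 4 k (heavy w)).
Local Notation x := (vars k).
Local Notation gap := (gap w).
Local Notation bad := (bad w).
Local Notation away := (away w).
Implicit Types (m a : 'X_{1..4}).

Lemma gapC m i j : gap m i j = gap m j i.
Proof. by rewrite /gap addnC wC. Qed.

Lemma gap_neq m i j : gap m i j -> i != j.
Proof. by apply: contraTneq => ->; rewrite /gap w0. Qed.

Lemma heavyN m : reflect (exists i j, gap m i j) (~~ heavy w m).
Proof.
apply: (iffP forallPn) => [[i /forallPn [j]]|[i [j ij]]].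
  by rewrite -ltnNge; exists i, j.
by exists i; apply/forallPn; exists j; rewrite -ltnNge.
Qed.

Lemma gap_shift m i j h p : h != i -> h != j ->
  gap (m + U_(h) *+ p)%MM i j = gap m i j.
Proof.
by move=> hi hj; rewrite /gap !mnmDE !mulmnE !mnm1E (negPf hi) (negPf hj) !addn0.
Qed.

Lemma gap_shift_big m i j h p : (wmax w <= p)%N -> gap (m + U_(h) *+ p)%MM i j ->
  h != i /\ h != j.
Proof.
rewrite /gap !mnmDE !mulmnE !mnm1E => le_p lt_w; have := le_wmax w i j.
by split; apply: contraTneq lt_w => ->; rewrite eqxx; lia.
Qed.

(** The coefficient of [u h] at the shifted exponent is that of the fraction on chart [h] at [m].
    The gap survives shifts along [h] and [l], so the section condition compares these two
    charts. *)
Lemma section_mcoeff n u m i j h l : section x I n u -> gap m i j ->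
  h != i -> h != j -> l != i -> l != j ->
  (u h)@_(m + U_(h) *+ n)%MM = (u l)@_(m + U_(l) *+ n)%MM.
Proof.
move=> su g hi hj li lj; apply/eqP; rewrite -subr_eq0; apply/eqP.
have := su h l (m + U_(h) *+ n + U_(l) *+ n)%MM.
rewrite mcoeffB !vars_exp !mcoeffMX_if lem_addl addmK.
rewrite -addmA (addmC (U_(h) *+ n)%MM) addmA lem_addl addmK; apply.
by apply/heavyN; exists i, j; rewrite !gap_shift.
Qed.

(** Such a coefficient is a pole along [x i]. A chart [h] off the gap has no such pole, since the
    other product is divisible by [x i ^+ n], so a gap avoiding [i] forces the coefficient to
    vanish. *)
Lemma section_mcoeff_small n u m i : section x I n u -> (m i < n)%N ->
  (u i)@_m != 0 -> forall j l, j != i -> l != i -> ~~ gap m j l.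
Proof.
move=> su lt_n nz j l ji li; apply: contraNN nz => g.
have [h /and3P [hi hj hl]] := avoid3 i j l.
have := su i h (m + U_(h) *+ n)%MM.
rewrite mcoeffB !vars_exp !mcoeffMX_if lem_addl addmK le_expU.
rewrite mnmDE mulmnE mnm1E (negPf hi) mul0n addn0 leqNgt lt_n subr0 => -> //.
by apply/heavyN; exists j, l; rewrite !gap_shift.
Qed.

Lemma gap_avoiding m i : (exists j l, [&& j != i, l != i & gap m j l]) ->
  [|| (i != 0) && (i != 1) && gap m 0 1, (i != 0) && (i != 2%:R) && gap m 0 2%:R,
      (i != 0) && (i != 3%:R) && gap m 0 3%:R, (i != 1) && (i != 2%:R) && gap m 1 2%:R,
      (i != 1) && (i != 3%:R) && gap m 1 3%:R | (i != 2%:R) && (i != 3%:R) && gap m 2%:R 3%:R].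
Proof.
case=> j [l /and3P [ji li g]]; have jl := gap_neq g; move: i j l ji li jl g.
do 3![apply: ord4_ind] => // _ _ _ g;
  by [rewrite g ?orbT | rewrite gapC in g; rewrite g ?orbT].
Qed.

(** Each gap identifies the values at the two vertices off it. Among the vertices avoided by some
    gap, two classes remain only when the gaps are exactly two opposite edges; all 64 patterns are
    checked. *)
Lemma values_of_gaps (V : zmodType) (g01 g02 g03 g12 g13 g23 : bool) (c0 c1 c2 c3 : V) :
  (g01 -> c2 = c3) -> (g02 -> c1 = c3) -> (g03 -> c1 = c2) ->
  (g12 -> c0 = c3) -> (g13 -> c0 = c2) -> (g23 -> c0 = c1) ->
  exists c d, [/\ [|| g12, g13 | g23] -> c0 = c,
    [|| g02, g03 | g23] -> c1 = c + d *+ ~~ g01,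
    [|| g01, g03 | g13] -> c2 = c + d *+ ~~ g02,
    [|| g01, g02 | g12] -> c3 = c + d *+ ~~ g03 &
    ~~ [|| [&& g01, g23, ~~ g02, ~~ g03, ~~ g12 & ~~ g13],
        [&& g02, g13, ~~ g01, ~~ g03, ~~ g12 & ~~ g23] |
        [&& g03, g12, ~~ g01, ~~ g02, ~~ g13 & ~~ g23]] -> d = 0].
Proof.
move=> H1 H2 H3 H4 H5 H6; pose b := [|| [&& g01, g23, ~~ g02, ~~ g03, ~~ g12 & ~~ g13],
        [&& g02, g13, ~~ g01, ~~ g03, ~~ g12 & ~~ g23] |
        [&& g03, g12, ~~ g01, ~~ g02, ~~ g13 & ~~ g23]].
(* With two classes, [c] is the value at the vertex 0 and [d] the jump to the other class. Otherwise
   [c] is the value at the first constrained vertex. *)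
exists (if b then c0 else if [|| g12, g13 | g23] then c0 else
        if [|| g02, g03 | g23] then c1 else c2),
   (if b then (if g01 then c2 else c1) - c0 else 0).
rewrite {}/b; case: g01 g02 g03 g12 g13 g23 H1 H2 H3 H4 H5 H6 => -[] [] [] [] [] /=;
  do 6![(move/(_ isT) => ?) || (move=> _)]; split=> //= _;
  rewrite ?mul0rn ?mulr0n ?mulr1n ?addr0 ?[c0 + _]addrC ?subrK; congruence.
Qed.

Lemma deficiency_values (V : zmodType) m (c : 'I_4 -> V) :
  (forall i j h l, gap m i j -> h != i -> h != j -> l != i -> l != j -> c h = c l) ->
  exists c0 d, (~~ bad m -> d = 0) /\
    forall i, (exists j l, [&& j != i, l != i & gap m j l]) -> c i = c0 + d *+ away m i.
Proof.
move=> H.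
have [c0 [d [H0 H1 H2 H3 Hd]]] := @values_of_gaps V (gap m 0 1) (gap m 0 2%:R)
  (gap m 0 3%:R) (gap m 1 2%:R) (gap m 1 3%:R) (gap m 2%:R 3%:R)
  (c 0) (c 1) (c 2%:R) (c 3%:R)
  (fun g => H _ _ 2%:R 3%:R g isT isT isT isT) (fun g => H _ _ 1 3%:R g isT isT isT isT)
  (fun g => H _ _ 1 2%:R g isT isT isT isT) (fun g => H _ _ 0 3%:R g isT isT isT isT)
  (fun g => H _ _ 0 2%:R g isT isT isT isT) (fun g => H _ _ 0 1 g isT isT isT isT).
exists c0, d; split.
  rewrite /bad /opposite_gaps (gapC m 2%:R 1) (gapC m 3%:R 1) (gapC m 3%:R 2%:R).
  exact: Hd.
by apply: ord4_ind => /gap_avoiding; rewrite /away /= ?addr0 ?orbF //; rewrite ?orbA in H0 H1 H2 H3 *.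
Qed.

(** Leaving out one vertex of each opposite edge leaves one vertex of each, so [y] and [z] are equal
    or joined by a cross edge. *)
Lemma opposite_gaps_cross m i j h l v v' y z : uniq [:: i; j; h; l] ->
  opposite_gaps w i j h l m -> v \in [:: h; l] -> v' \in [:: i; j] ->
  y != v -> y != v' -> z != v -> z != v' -> ~~ gap m y z.
Proof.
move=> un /and5P [_ _ n1 n2 /andP [n3 n4]] vin vin' yv yv' zv zv'.
have [n1' n2' n3' n4'] : [/\ ~~ gap m h i, ~~ gap m l i, ~~ gap m h j & ~~ gap m l j].
  by rewrite !(gapC _ _ i) !(gapC _ _ j).
have nn u : ~~ gap m u u by rewrite /gap w0.
move: (uniq4_cover y un) (uniq4_cover z un) yv yv' zv zv' vin vin'; rewrite !inE.
move=> /or4P [] /eqP -> /or4P [] /eqP -> //;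
  move=> yv yv' zv zv' /orP [] /eqP E /orP [] /eqP E'; subst v v';
  by rewrite ?eqxx in yv yv' zv zv'.
Qed.

Lemma bad_opposite_gaps m : bad m ->
  exists a b c : 'I_4, uniq [:: 0; a; b; c] /\ opposite_gaps w 0 a b c m.
Proof.
by case/or3P=> og; [exists 1, 2%:R, 3%:R | exists 2%:R, 1, 3%:R | exists 3%:R, 1, 2%:R].
Qed.

Lemma bad_away m i j h l : h != i -> h != j -> l != i -> l != j ->
  bad m -> away m i -> ~~ away m j -> ~~ gap m h l.
Proof.
move=> hi hj li lj /bad_opposite_gaps [a [b [c [un og]]]] /andP [i0 gi] aj.
have /and5P [g0a _ n0b n0c _] := og.
apply: (opposite_gaps_cross un og _ _ hi hj li lj).
  have := uniq4_cover i un; rewrite !inE (negPf i0) /=.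
  by case/or3P=> [/eqP E|->|->] //; rewrite ?orbT //; rewrite E g0a in gi.
have [b0 c0] : b != 0 /\ c != 0.
  by move: un; rewrite /= !inE !negb_or !(eq_sym 0) => /andP [/and3P [_ -> ->]].
have := uniq4_cover j un; rewrite !inE orbA => /orP [//|/orP [] /eqP E];
  by move: aj; rewrite E /away ?b0 ?c0 ?n0b ?n0c.
Qed.

(** On an overlap of a chart in [e] with one outside, a gap surviving both large shifts avoids both
    indices, which the hypothesis excludes. The monomial is therefore zero there and glues with
    0. *)
Lemma section_component n a (e : pred 'I_4) : (wmax w <= n)%N ->
  (forall i j h l, e i -> ~~ e j -> h != i -> h != j -> l != i -> l != j -> ~~ gap a h l) ->
  section x I n (fun i => if e i then x i ^+ n * 'X_[a] else 0).
Proof.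
move=> le_n He; have idI := is_ideal_mono k (@up_closed_heavy w); have [I0 _ _] := idI.
have H i j : e i -> ~~ e j -> I (x i ^+ n * 'X_[a] * x j ^+ n).
  move=> ei ej; rewrite !vars_exp -!mpolyXD; apply/mono_mpolyX.
  apply/negPn/negP => /heavyN [h [l g]].
  have [jh jl] := gap_shift_big le_n g.
  rewrite gap_shift // addmC in g.
  have [ih il] := gap_shift_big le_n g.
  rewrite gap_shift // in g.
  by have := He i j h l ei ej; rewrite ![_ == i]eq_sym ![_ == j]eq_sym ih il jh jl g; move/(_ isT isT isT isT).
move=> i j; case: ifPn => ei; case: ifPn => ej.
- by rewrite [X in I X](_ : _ = 0) //; ring.
- by rewrite mul0r subr0; apply: H.
- by rewrite mul0r sub0r; apply: (is_idealN idI); apply: H.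
- by rewrite !mul0r subr0.
Qed.

Lemma mcoeffMvar (f : R) i p m :
  (f * x i ^+ p)@_m = if (p <= m i)%N then f@_(m - U_(i) *+ p)%MM else 0.
Proof. by rewrite vars_exp mcoeffMX_if le_expU. Qed.

Lemma mcoeffMvar_shift (f : R) i p m : (f * x i ^+ p)@_(m + U_(i) *+ p)%MM = f@_m.
Proof. by rewrite vars_exp mcoeffMX_if lem_addl addmK. Qed.

Lemma section_decomposition n u : section x I n u -> exists r e : R, forall m,
  (~~ bad m -> e@_m = 0) /\
  forall i, (exists j l, [&& j != i, l != i & gap m j l]) ->
    (u i)@_(m + U_(i) *+ n)%MM = r@_m + e@_m *+ away m i.
Proof.
move=> su; pose b := \max_i msize (u i).
pose P m c d := (~~ bad m -> d = 0) /\
  forall i, (exists j l, [&& j != i, l != i & gap m j l]) ->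
    (u i)@_(m + U_(i) *+ n)%MM = c + d *+ away m i.
have P0 m : (b <= mdeg m)%N -> P m 0 0.
  move=> ge_m; split=> // i _; rewrite mul0rn addr0 memN_msupp_eq0 //.
  apply: msize_mdeg_ge; rewrite mdegD; apply: leq_trans (leq_addr _ _).
  by apply: leq_trans ge_m; apply: (leq_bigmax i).
(* [r] is chosen first and made 0 from degree [b] on, so that [e] can be 0 there too and both are
   polynomials. *)
have [m|m ge_m|r Hr] :=
    @mpoly_choice 4 k (fun m c => (exists d, P m c d) /\ ((b <= mdeg m)%N -> c = 0)) b.
- case: (leqP b (mdeg m)) => [/P0|_]; first by exists 0; split=> //; exists 0.
  suff [c [d Pmcd]] : exists c d, P m c d by exists c; split=> //; exists d.
  apply: deficiency_values => i j h l g hi hj li lj.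
  exact: section_mcoeff su g hi hj li lj.
- by split=> //; exists 0; apply: P0.
have [m|m ge_m|e He] := @mpoly_choice 4 k (fun m d => P m r@_m d) b; last by exists r, e.
  by case: (Hr m).
by case: (Hr m) => _ -> //; apply: P0.
Qed.

Lemma mdeg4 m : mdeg m = (m 0%R + m 1%R + m 2%:R%R + m 3%:R%R)%N.
Proof.
rewrite mdegE !big_ord_recl big_ord0 addn0 !addnA.
by congr (_ + m _ + m _ + m _)%N; apply: val_inj.
Qed.

(** Two opposite gaps bound all four exponents, so this bounded type holds every bad exponent. *)
Definition bad_degree : finType := {a : 'X_{1..4 < (2 * wmax w).+1} | bad a}.

Lemma bad_mdeg m : bad m -> (mdeg m < (2 * wmax w).+1)%N.
Proof.
rewrite mdeg4; have le_w i j (g : gap m i j) := leq_trans g (le_wmax w i j).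
by case/or3P=> /and5P [/le_w + /le_w + _ _ _]; lia.
Qed.

Lemma spanned_bad_degree : spanned x (@constants k) I bad_degree.
Proof.
pose s (p : bad_degree) i : R :=
  if away (val p) i then x i ^+ wmax w * 'X_[val (val p)] else 0.
exists (wmax w), s; split=> [p|n u su].
  apply: section_component => // i j h l ei ej hi hj li lj.
  exact: bad_away hi hj li lj (valP p) ei ej.
have [r [e Hre]] := section_decomposition su.
exists (fun p => (e@_(val (val p)))%:MP), r, (wmax w).
split=> [p|i]; first by exists e@_(val (val p)).
(* The amount by which the section differs from [r] on chart [i]. *)
pose f : R := \sum_p (e@_(val (val p)))%:MP *
  (if away (val (val (p : bad_degree))) i then 'X_[val (val p)] else 0).
have fE m : f@_m = if bad m then e@_m *+ away m i else 0.
  rewrite /f raddf_sum /=; case: ifPn => [bm|nbm].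
    rewrite (bigD1 (Sub (Sub m (bad_mdeg bm)) bm)) //= big1 ?addr0.
      by rewrite mcoeffCM; case: away; rewrite ?mcoeffX ?eqxx ?mulr1 ?mcoeff0 ?mulr0.
    move=> p ne_p; rewrite mcoeffCM; case: away; rewrite ?mcoeff0 ?mulr0 //.
    rewrite mcoeffX; case: eqP => [eq_pm|]; rewrite ?mulr0 //.
    by case/negP: ne_p; apply/eqP/val_inj/val_inj.
  rewrite big1 // => p _; rewrite mcoeffCM; case: away; rewrite ?mcoeff0 ?mulr0 //.
  rewrite mcoeffX; case: eqP => [eq_pm|]; rewrite ?mulr0 //.
  by case/negP: nbm; rewrite -eq_pm; apply: (valP p).
have -> : (u i * x i ^+ wmax w - \sum_p (e@_(val (val p)))%:MP * s p i * x i ^+ n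
     - r * x i ^+ (n + wmax w)) * x i ^+ wmax w =
   (u i - f * x i ^+ n - r * x i ^+ n) * x i ^+ (wmax w + wmax w).
  have -> : \sum_p (e@_(val (val p)))%:MP * s p i * x i ^+ n = f * x i ^+ (n + wmax w).
    rewrite /f mulr_suml; apply: eq_bigr => p _; rewrite /s exprD.
    by case: away; ring.
  by rewrite !exprD; ring.
(* The factor [x i ^+ (wmax w + wmax w)] closes every gap at [i], so only gaps avoiding [i] have to
   be checked. *)
move=> m; rewrite mcoeffMvar; case: leqP => // le_m /heavyN [j [l g]].
have Em : m = (m - U_(i) *+ (wmax w + wmax w) + U_(i) *+ (wmax w + wmax w))%MM.
  by rewrite submK // le_expU.
move: g; rewrite {1}Em => g; have [ij il] := gap_shift_big (leq_addr _ _) g.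
rewrite gap_shift // in g; move: (m - _)%MM g => {Em le_m} {}m g.
rewrite !mcoeffB !mcoeffMvar; case: leqP => [le_n|lt_n]; last first.
  rewrite !subr0; apply/eqP/negPn/negP => nz.
  have := section_mcoeff_small su lt_n nz; move/(_ j l).
  by rewrite !(eq_sym _ i) ij il g => /(_ isT isT).
have Em : m = (m - U_(i) *+ n + U_(i) *+ n)%MM by rewrite submK // le_expU.
rewrite {1}Em; move: g; rewrite {1}Em gap_shift // => g.
move: (m - _)%MM g => {Em le_n} {}m g; have [e0 ->] := Hre m; last first.
  by exists j, l; rewrite !(eq_sym _ i) ij il.
rewrite fE; case: ifPn => [_|/e0 ->]; first by rewrite addrK subrr.
by rewrite mul0rn addr0 subr0 subrr.
Qed.

End Deficiency.

(** * Linear independence of deficiency classes *)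

Section Independence.
Variables (k : fieldType) (w : 'I_4 -> 'I_4 -> nat).
Hypotheses (w0 : forall i, w i i = 0%N) (wC : forall i j, w i j = w j i).
Local Notation R := {mpoly k[4]}.
Local Notation I := (@mono 4 k (heavy w)).
Local Notation x := (vars k).

(** With more than #|T| sections, some nontrivial combination [z] has zero coordinates, hence equals
    a global [rr]. At [a p], charts [h] and [l] give [rr] the coefficient [z 0 p], while charts [i]
    and [j] give 0. *)
Lemma card_bad_family (T : finType) i j h l q (a : 'I_q -> 'X_{1..4}) :
  uniq [:: i; j; h; l] -> injective a -> (forall p, opposite_gaps w i j h l (a p)) ->
  spanned x (@constants k) I T -> (q <= #|T|)%N.
Proof.
move=> un inj_a bad_a [n0 [s [_ Hs]]]; rewrite leqNgt; apply/negP => lt_Tq.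
have idI := is_ideal_mono k (@up_closed_heavy w); have [_ _ IM] := idI.
pose e v := (v == h) || (v == l); pose n := wmax w.
have eN v : ~~ e v -> v = i \/ v = j.
  move: (uniq4_cover v un); rewrite !inE /e.
  by case/or4P=> /eqP ->; rewrite ?eqxx ?orbT //; [left|right].
pose u p v := if e v then x v ^+ n * 'X_[a p] else 0.
have su p : section x I n (u p).
  apply: section_component => // v v' y z ev /eN ev' yv yv' zv zv'; apply/negP => g.
  have vin : v \in [:: h; l] by rewrite !inE.
  have vin' : v' \in [:: i; j] by rewrite !inE; case: ev' => ->; rewrite eqxx ?orbT.
  by have := opposite_gaps_cross w0 wC un (bad_a p) vin vin' yv yv' zv zv'; rewrite g.
have [c Hc] := fin_all_exists (fun p => Hs _ _ (su p)).
have [r Hr] := fin_all_exists Hc; have [m Hm] := fin_all_exists Hr.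
have [C HC] := fin_all_exists (fun p => fin_all_exists (Hm p).1).
pose A := \matrix_(p < q, t < #|T|) C p (enum_val t).
have /rowV0Pn [z /sub_kermxP zA z0] : kermx A != 0.
  rewrite kermx_eq0 /row_free neq_ltn (leq_ltn_trans _ lt_Tq) //.
  exact: rank_leq_col.
have zC t : \sum_p z 0 p * C p t = 0.
  transitivity ((z *m A) 0 (enum_rank t)); last by rewrite zA mxE.
  by rewrite mxE; apply: eq_bigr => p _; rewrite mxE enum_rankK.
pose M := \sum_p m p; pose rr := \sum_p (z 0 p)%:MP * r p.
have key v : I ((\sum_p (z 0 p)%:MP * (if e v then 'X_[a p] else 0) - rr)
                * x v ^+ (n + n0 + M)).
  have -> : (\sum_p (z 0 p)%:MP * (if e v then 'X_[a p] else 0) - rr) * x v ^+ (n + n0 + M) =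
    \sum_p ((z 0 p)%:MP * x v ^+ (M - m p)) *
      ((u p v * x v ^+ n0 - \sum_t c p t * s t v * x v ^+ n - r p * x v ^+ (n + n0)) * x v ^+ m p).
    have EM p : M = (M - m p + m p)%N by rewrite subnK // /M (bigD1 p) //= leq_addr.
    have E0 : \sum_p (z 0 p)%:MP * (\sum_t c p t * s t v * x v ^+ n) = 0.
      under eq_bigr => p _ do rewrite mulr_sumr.
      rewrite exchange_big big1 //= => t _.
      have -> : \sum_p (z 0 p)%:MP * (c p t * s t v * x v ^+ n) =
          (\sum_p z 0 p * C p t)%:MP * (s t v * x v ^+ n).
        rewrite rmorph_sum mulr_suml; apply: eq_bigr => p _.
        by rewrite HC /= mpolyCM; ring.
      by rewrite zC mpolyC0 mul0r.
    transitivity (\sum_p ((z 0 p)%:MP * (if e v then 'X_[a p] else 0) * x v ^+ (n + n0 + M)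
      - (z 0 p)%:MP * (\sum_t c p t * s t v * x v ^+ n) * x v ^+ M
      - (z 0 p)%:MP * r p * x v ^+ (n + n0 + M))).
      by rewrite !sumrB -!mulr_suml E0 mul0r subr0 mulrBl.
    apply: eq_bigr => p _; rewrite /u {1 2 3}(EM p) !exprD; case: (e v); ring.
  by apply: (is_ideal_sum idI) => p; apply: (IM); apply: (Hm p).2.
have rr_coef v p : (e v -> z 0 p = rr@_(a p)) /\ (~~ e v -> rr@_(a p) = 0).
  have := key v (a p + U_(v) *+ (n + n0 + M))%MM; rewrite mcoeffMvar_shift => key_v.
  have {}key_v : (\sum_p (z 0 p)%:MP * (if e v then 'X_[a p] else 0) - rr)@_(a p) = 0.
    apply: key_v; apply/heavyN.
    case/and5P: (bad_a p) => gij ghl _ _ _.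
    move: un; rewrite /= !inE !negb_or => /and4P [/and3P [ij ih il] /andP [jh jl] hl _].
    case: (boolP (e v)) => [/orP [] /eqP ->|/eN [] ->];
      [exists i, j|exists i, j|exists h, l|exists h, l];
      by rewrite gap_shift // eq_sym.
  move: key_v; rewrite mcoeffB raddf_sum /=; case: (e v) => /eqP; rewrite subr_eq0.
    rewrite (bigD1 p) //= big1 => [|p' ne_p]; rewrite mcoeffCM mcoeffX ?eqxx.
      by rewrite mulr1 addr0 => /eqP.
    by rewrite (inj_eq inj_a) (negPf ne_p) mulr0.
  by rewrite big1 => [/eqP <-|p' _]; last rewrite mulr0 mcoeff0.
case/negP: z0; apply/eqP/rowP => p; rewrite mxE.
have [/(_ _)-> //] := rr_coef h p; last by rewrite /e eqxx.
have [_ -> //] := rr_coef i p.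
by move: un; rewrite /e /= !inE !negb_or => /and4P [/and3P [_ -> ->]].
Qed.

End Independence.

(** * Counting *)

Lemma sum_uniq4 (i j h l : 'I_4) (F : 'I_4 -> nat) : uniq [:: i; j; h; l] ->
  (\sum_u F u = F i + F j + F h + F l)%N.
Proof.
move=> un; transitivity (\sum_(u <- [:: i; j; h; l]) F u)%N.
  apply: perm_big; apply: uniq_perm => // [|u]; first exact: index_enum_uniq.
  by rewrite uniq4_cover // mem_index_enum.
by rewrite !big_cons big_nil addn0 !addnA.
Qed.

Section Counting.
Variables (k : fieldType) (w : 'I_4 -> 'I_4 -> nat).
Hypotheses (w0 : forall i, w i i = 0%N) (wC : forall i j, w i j = w j i).
Variable d : nat.
Hypothesis gen_d : forall m, heavy w m -> exists2 a, heavy w a & (a <= m)%MM && (mdeg a == d).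

Lemma vertex_weight_le i : (\sum_j w i j <= d)%N.
Proof.
(* A monomial of the ideal without the variable [i]: a generator dividing it has exponent 0 at [i],
   hence at least [w i j] at each [j]. *)
pose m : 'X_{1..4} := [multinom (if j == i then 0 else wmax w)%N | j < 4].
have [|a /heavyP a_heavy /andP [/mnm_lepP a_le /eqP <-]] := gen_d (m := m).
  apply/heavyP => j l; rewrite !mnmE.
  case: (j =P i) => [->|_]; last exact: leq_trans (le_wmax _ _ _) (leq_addr _ _).
  by case: (l =P i) => [->|_]; rewrite ?w0 // le_wmax.
rewrite mdegE; apply: leq_sum => j _; have := a_heavy i j.
by have := a_le i; rewrite !mnmE eqxx leqn0 => /eqP ->.
Qed.

Section OppositeGaps.
Variables (i j h l : 'I_4) (m : 'X_{1..4}).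
Hypotheses (un : uniq [:: i; j; h; l]) (og : opposite_gaps w i j h l m).

Let neqs : [/\ [/\ i != j, i != h & i != l], j != h, j != l & h != l].
Proof.
move: un; rewrite /= !inE !negb_or => /and4P [/and3P [ij ih il] /andP [jh jl] hl _].
by split.
Qed.

Let multinom4 a b c e : exists m' : 'X_{1..4}, [/\ m' i = a, m' j = b, m' h = c & m' l = e].
Proof.
exists [multinom (if u == i then a else if u == j then b else if u == h then c else e) | u < 4].
have [[ij ih il] jh jl hl] := neqs.
rewrite !mnmE !eqxx (eq_sym j i) (eq_sym h i) (eq_sym l i) (eq_sym h j) (eq_sym l j).
by rewrite (eq_sym l h) (negPf ij) (negPf ih) (negPf il) (negPf jh) (negPf jl) (negPf hl).
Qed.

Let ogE : [/\ (m i + m j < w i j)%N, (m h + m l < w h l)%N,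
  (w i h <= m i + m h)%N /\ (w i l <= m i + m l)%N &
  (w j h <= m j + m h)%N /\ (w j l <= m j + m l)%N].
Proof.
by case/and5P: og => g1 g2; rewrite /gap -!leqNgt => n1 n2 /andP [n3 n4].
Qed.

Lemma degree_le_opposite : (d <= w i j + w h l)%N.
Proof.
have [g1 g2 [n1 n2] [n3 n4]] := ogE.
(* Raising [m i] and [m h] just enough to close both gaps gives degree [w i j + w h l]. *)
have [a [ai aj ah al]] := multinom4 (w i j - m j) (m j) (w h l - m l) (m l).
have [|b _ /andP [/mnm_lepP le_ba /eqP <-]] := gen_d (m := a).
  apply/heavyP => u v; have := (uniq4_cover u un, uniq4_cover v un); rewrite !inE.
  have W0 := w0; have WC := wC.
  case=> /or4P [] /eqP -> /or4P [] /eqP ->; rewrite ?ai ?aj ?ah ?al ?w0 //;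
    rewrite ?(wC j i) ?(wC h i) ?(wC l i) ?(wC h j) ?(wC l j) ?(wC l h); lia.
apply: (@leq_trans (mdeg a)); first by rewrite !mdegE; apply: leq_sum => u _; apply: le_ba.
by rewrite mdegE (sum_uniq4 _ un) ai aj ah al; lia.
Qed.

(** Cancelling the common edge in the vertex sums bounded by [w i j + w h l] leaves four
    inequalities. With them, each exponent from 1 to [w i j - 2] at [i] extends to a bad exponent,
    and independence bounds their number. *)
Lemma weight_le_card (T : finType) :
  spanned (vars k) (@constants k) (mono (heavy w)) T -> (w i j <= #|T| + 2)%N.
Proof.
move=> sp; have [g1 g2 [n1 n2] [n3 n4]] := ogE.
have le_d v := leq_trans (vertex_weight_le v) degree_le_opposite.
have [fi fj fh fl] : [/\ w i h + w i l <= w h l, w j h + w j l <= w h l,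
    w i h + w j h <= w i j & w i l + w j l <= w i j]%N.
  have := (le_d i, le_d j, le_d h, le_d l); rewrite !(sum_uniq4 _ un) !w0.
  rewrite (wC j i) (wC h i) (wC l i) (wC h j) (wC l j) (wC l h).
  by case=> [[[di dj] dh] dl]; split; lia.
have /fin_all_exists [a Ha] (t : 'I_(w i j - 2)) : exists a : 'X_{1..4},
    opposite_gaps w i j h l a /\ a i = t.+1.
  have lt_t := ltn_ord t.
  (* The least exponent at [h] that leaves no gap on [ih] and [jh]; on [ij] and [hl] the sums are
     one below the weights. Omitting exponent 0 at [i] and [j] keeps [c] below [w h l], and [m]
     supplies a slack of 2 in comparing [w i l + w j h] and [w i h + w j l] with [w i j + w h l]. *)
  pose c := maxn (w i h - t.+1) (w j h + t.+2 - w i j).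
  have [a [ai aj ah al]] := multinom4 t.+1 (w i j - t.+2) c (w h l - c.+1).
  exists a; split=> //; rewrite /opposite_gaps /gap ai aj ah al -!leqNgt /c.
  by apply/and5P; split; [..|apply/andP; split]; lia.
have := @card_bad_family k w w0 wC T i j h l _ a un _ (fun t => (Ha t).1) sp.
rewrite leq_subLR addnC; apply=> t t' E; apply/val_inj/succn_inj.
by rewrite -(Ha t).2 -(Ha t').2 E.
Qed.

End OppositeGaps.

(** Both opposite weights are at most #|T| + 2 by symmetry; their sum bounds [d], and [d] bounds
    every weight. *)
Lemma weight_bound (T : finType) u v m : bad w m ->
  spanned (vars k) (@constants k) (mono (heavy w)) T -> (w u v <= 2 * #|T| + 4)%N.
Proof.
move=> /bad_opposite_gaps [j [h [l [un og]]]] sp.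
have le1 := weight_le_card un og sp.
have un' : uniq [:: h; l; 0; j] by rewrite (@uniq_catC _ [:: h; l] [:: 0; j]).
have og' : opposite_gaps w h l 0 j m.
  rewrite /opposite_gaps !(gapC wC m h) !(gapC wC m l).
  by case/and5P: og => -> -> -> -> /andP [-> ->].
have le2 := weight_le_card un' og' sp.
apply: leq_trans (_ : d <= _)%N; last first.
  by apply: leq_trans (degree_le_opposite un og) _; lia.
by apply: leq_trans (vertex_weight_le u); rewrite (bigD1 v) //= leq_addr.
Qed.

End Counting.

(** * From a linear resolution to a finite list of curves *)

Lemma linear_resolution_generated (k : fieldType) t :
  linear_resolution (@tetrahedral k t) -> exists d, forall m, heavy (weight t) m ->
    exists2 a, heavy (weight t) a & (a <= m)%MM && (mdeg a == d).
Proof.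
case=> d [n [g [_ [g_hom [tE _]]]]]; exists d.
(* The ideal of the monomials divisible by a degree [d] monomial of the tetrahedral ideal; it
   contains the generators, hence the whole ideal. *)
pose Q (f : {mpoly k[4]}) := forall m, f@_m != 0 ->
  exists2 a, heavy (weight t) a & (a <= m)%MM && (mdeg a == d).
have idQ : is_ideal Q.
  split=> [m|f f' Qf Qf' m|f f' Qf' m]; first by rewrite mcoeff0 eqxx.
    rewrite -mcoeff_msupp => /msuppD_le; rewrite mem_cat !mcoeff_msupp.
    by case/orP=> [/Qf|/Qf'].
  rewrite -mcoeff_msupp => /msuppM_le /allpairsP [[a b] /= [_ Hb ->]].
  rewrite mcoeff_msupp in Hb; have [c Hc /andP [le_cb dc]] := Qf' _ Hb.
  by exists c; rewrite ?dc ?andbT //; apply: lepm_trans le_cb (lem_addl _ _).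
move=> m hm; have : tetrahedral t ('X_[m] : {mpoly k[4]}) by apply/tetrahedralE/mono_mpolyX.
move/tE/(span_min idQ); apply; last by rewrite mcoeffX eqxx oner_neq0.
move=> _ [j ->] a nz; exists a; last first.
  rewrite lepm_refl; have /allP := g_hom j; apply.
  by rewrite mcoeff_msupp.
have /tetrahedralE /monoP : tetrahedral t (g j 0) by apply/tE/span_gen; exists j.
exact.
Qed.

Lemma tnth_weight t (i : 'I_6) : exists u v, tnth t i = weight t u v.
Proof.
case: i => [[|[|[|[|[|[|//]]]]]] lt_i].
- by exists 0, 1; congr tnth; apply: val_inj.
- by exists 0, 2%:R; congr tnth; apply: val_inj.
- by exists 0, 3%:R; congr tnth; apply: val_inj.
- by exists 1, 2%:R; congr tnth; apply: val_inj.
- by exists 1, 3%:R; congr tnth; apply: val_inj.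
- by exists 2%:R, 3%:R; congr tnth; apply: val_inj.
Qed.

Theorem theorem6p5 (k : fieldType) (t0 : 6.-tuple nat) :
  ~ ACM (@tetrahedral k t0) ->
  exists S : seq (6.-tuple nat),
    forall t : 6.-tuple nat,
      evenly_linked (@tetrahedral k t0) (@tetrahedral k t) ->
      linear_resolution (@tetrahedral k t) ->
      t \in S.
Proof.
move=> nACM.
have sp t : spanned (vars k) (@constants k) (tetrahedral t) (bad_degree (weight t)).
  apply: spanned_ext (spanned_bad_degree k (weight_diag t) (weightC t)) => f.
  by apply: iff_sym; apply: tetrahedralE.
pose N := (2 * #|bad_degree (weight t0)| + 4)%N.
exists [seq map_tuple (@nat_of_ord N.+1) u | u <- enum {: 6.-tuple 'I_N.+1}] => t t0t.
case/linear_resolution_generated => d gen_d.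
(* If [t] has no bad exponent, the empty family spans for [t], and by reversing the links also for
   [t0], which would then be ACM. *)
have [/= b _|no_bad] := pickP (@predT (bad_degree (weight t))); last first.
  case: nACM; apply: (@ACM_of_spanned k t0 (bad_degree (weight t))).
    by move=> b; have := no_bad b.
  exact: spanned_evenly_linked (evenly_linked_sym t0t) (sp t).
have spt := spanned_ext (@tetrahedralE k t) (spanned_evenly_linked t0t (sp t0)).
have le_N i : (tnth t i < N.+1)%N.
  have [u [v ->]] := tnth_weight t i; rewrite ltnS.
  exact: leq_trans (weight_bound (weight_diag t) (weightC t) gen_d u v (valP b) spt) (leqnn _).
apply/mapP; exists (map_tuple inord t); first by rewrite mem_enum.
by apply: eq_from_tnth => i; rewrite !tnth_map inordK.
Qed.
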